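(* The graph $G$ (defined in the context) is a fastened $\{K_4,K_{2,2,2}\}$-ultrahomogeneous $\{K_4\}_{42}^4\{K_{2,2,2}\}_{21}^3$-graph which is not line-graphical, and its automorphism group $\mathcal A(G)$ satisfies $|\mathcal A(G)|=1008=4|E(G)|$. Moreover, $\mathcal A(G)$ acts transitively on the edges of $G$ with edge stabilizer $\Gamma$ of order 4 (so the edges of $G$ correspond to the left cosets of $\Gamma$ in $\mathcal A(G)$), and acts transitively on the vertices with vertex stabilizer of order 24 (so the vertices correspond to the left cosets of a subgroup of order 24).
   Context: The Fano plane $\mathcal F$ has points $1,\dots,7$ and lines $\{1,2,3\},\{1,4,5\},\{1,6,7\},\{2,4,6\},\{2,5,7\},\{3,4,7\},\{3,5,6\}$. For a point $p$, the three lines through $p$ are $\{p,q,r\}$ for three disjoint pairs $\{q,r\}$ partitioning $\mathcal F\setminus\{p\}$. An ordered pencil through $p$ is a tuple $v=(p,q_ar_a,q_br_b,q_cr_c)$ in which $q_ar_a,q_br_b,q_cr_c$ are these three (unordered) pairs listed in a chosen linear order. The graph $G$ has the 42 ordered pencils as vertices, with $v=(p,q_ar_a,q_br_b,q_cr_c)$ and $v'=(p',q'_ar'_a,q'_br'_b,q'_cr'_c)$ adjacent iff $p\neq p'$ and $|\{q_i,r_i\}\cap\{q'_i,r'_i\}|=1$ for each $i\in\{a,b,c\}$. A copy of $H$ in $G$ is an induced subgraph isomorphic to $H$. For a connected regular graph $H$ and integers $1<m<n$, an $\{H\}_n^m$-graph is a connected graph that (a) is an edge-disjoint union of $n$ induced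 copies of $H$; (b) has exactly $m$ copies of $H$ containing each vertex, no two of which share more than one vertex; (c) has exactly $n$ induced subgraphs isomorphic to $H$. An $\{H_1\}_{n_1}^{m_1}\{H_2\}_{n_2}^{m_2}$-graph ($H_1\ne H_2$) is one that is both an $\{H_1\}_{n_1}^{m_1}$-graph and an $\{H_2\}_{n_2}^{m_2}$-graph. It is $\{H_1,H_2\}$-ultrahomogeneous if for each $i=1,2$ every isomorphism between two copies of $H_i$ in it extends to an automorphism of the whole graph. It is fastened if each edge lies in exactly one copy of $H_1$ and exactly one copy of $H_2$. It is line-graphical if $\min(m_1,m_2)=m_1=2$ and $H_1$ is a complete graph. *)

(* Defs.v *)
From HB Require Import structures.
From mathcomp Require Import all_boot all_fingroup.

Set Implicit Arguments.
Unset Strict Implicit.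
Unset Printing Implicit Defensive.

Local Open Scope group_scope.

Record sgraph := SGraph {
  svertex :> finType;
  adj : rel svertex;
  adj_sym : symmetric adj;
  adj_irr : irreflexive adj }.

Arguments adj {s}.

Definition edges (G : sgraph) : {set {set G}} :=
  [set [set e.1; e.2] | e : G * G & adj e.1 e.2].

Definition connected_graph (G : sgraph) : Prop :=
  (0 < #|G|)%N /\ forall x y : G, connect adj x y.

Definition regular_graph (G : sgraph) : Prop :=
  exists k : nat, forall x : G, #|[set y | adj x y]| = k.

Definition complete_graph (G : sgraph) : Prop :=
  forall x y : G, x != y -> adj x y.

Definition isomorphic (H K : sgraph) : Prop :=
  exists f : H -> K, bijective f /\ forall x y, adj (f x) (f y) = adj x y.

Lemma complete_sym n : symmetric (fun x y : 'I_n => x != y).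
Proof. by move=> x y; rewrite eq_sym. Qed.

Lemma complete_irr n : irreflexive (fun x y : 'I_n => x != y).
Proof. by move=> x; rewrite eqxx. Qed.

Definition Kcomplete (n : nat) : sgraph :=
  SGraph (@complete_sym n) (@complete_irr n).

Definition multipartite_adj (r t : nat) : rel ('I_r * 'I_t) :=
  fun x y => x.1 != y.1.

Lemma multipartite_sym r t : symmetric (@multipartite_adj r t).
Proof. by move=> x y; rewrite /multipartite_adj eq_sym. Qed.

Lemma multipartite_irr r t : irreflexive (@multipartite_adj r t).
Proof. by move=> x; rewrite /multipartite_adj eqxx. Qed.

(* The complete r-partite graph whose r parts all have size t. *)
Definition Kmultipartite (r t : nat) : sgraph :=
  SGraph (@multipartite_sym r t) (@multipartite_irr r t).

Definition K4 : sgraph := Kcomplete 4.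
Definition K222 : sgraph := Kmultipartite 3 2.

(* An induced subgraph is represented by its vertex set A; its edges are the  *)
(* edges of G contained in A.                                                 *)
Definition edges_in (G : sgraph) (A : {set G}) : {set {set G}} :=
  [set e in edges G | e \subset A].

Definition copies (H G : sgraph) : {set {set G}} :=
  [set A : {set G} | [exists f : {ffun H -> G},
     [&& injectiveb f, f @: [set: H] == A
       & [forall x, forall y, adj (f x) (f y) == adj x y]]]].

Definition edge_disjoint_union (H G : sgraph) (n : nat) : Prop :=
  exists S : {set {set G}},
    [/\ #|S| = n,
        S \subset copies H G,
        {in S &, forall A B, A != B -> [disjoint edges_in A & edges_in B]},
        \bigcup_(A in S) A = [set: G]
      & \bigcup_(A in S) edges_in A = edges G].

Definition Hgraph (H : sgraph) (n m : nat) (G : sgraph) : Prop :=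
  [/\ connected_graph H /\ regular_graph H,
      (1 < m < n)%N,
      connected_graph G
    & [/\ edge_disjoint_union H G n,
          forall x : G,
            #|[set A in copies H G | x \in A]| = m /\
            {in [set A in copies H G | x \in A] &,
               forall A B, A != B -> (#|A :&: B| <= 1)%N}
        & #|copies H G| = n]].

Definition HHgraph (H1 : sgraph) (n1 m1 : nat) (H2 : sgraph) (n2 m2 : nat)
    (G : sgraph) : Prop :=
  [/\ ~ isomorphic H1 H2, Hgraph H1 n1 m1 G & Hgraph H2 n2 m2 G].

Definition graph_aut (G : sgraph) : {set {perm G}} :=
  [set s : {perm G} | [forall x, forall y, adj (s x) (s y) == adj x y]].

Lemma graph_aut_group_set G : group_set (graph_aut G).
Proof.
apply/group_setP; split=> [|s t].
  by rewrite inE; apply/'forall_forallP=> x y; rewrite !perm1.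
rewrite !inE => /'forall_forallP sP /'forall_forallP tP.
apply/'forall_forallP=> x y.
by rewrite !permM (eqP (tP _ _)) (eqP (sP _ _)).
Qed.

Canonical graph_aut_group G := Group (graph_aut_group_set G).

(* An isomorphism between the induced subgraphs on A and B is given by a map  *)
(* on all of G, of which only the values on A matter.                         *)
Definition copy_iso (G : sgraph) (A B : {set G}) (f : G -> G) : Prop :=
  [/\ {in A &, injective f}, f @: A = B
    & {in A &, forall x y, adj (f x) (f y) = adj x y}].

Definition iso_extend (H G : sgraph) : Prop :=
  forall (A B : {set G}) (f : G -> G),
    A \in copies H G -> B \in copies H G -> copy_iso A B f ->
    exists2 s : {perm G}, s \in graph_aut G & {in A, s =1 f}.

Definition ultrahomogeneous (H1 H2 G : sgraph) : Prop :=
  iso_extend H1 G /\ iso_extend H2 G.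

Definition fastened (H1 H2 G : sgraph) : Prop :=
  {in edges G, forall e : {set G},
     #|[set A in copies H1 G | e \subset A]| = 1%N /\
     #|[set A in copies H2 G | e \subset A]| = 1%N}.

Definition line_graphical (H1 : sgraph) (n1 m1 : nat)
    (H2 : sgraph) (n2 m2 : nat) (G : sgraph) : Prop :=
  [/\ HHgraph H1 n1 m1 H2 n2 m2 G,
      minn m1 m2 = m1, m1 = 2 & complete_graph H1].

(* The points of X correspond to the cosets in A of the stabilizer S of x, s x*)
(* corresponding to the coset of s. The product of permutations applies its   *)
(* left factor first, so the left coset {s o g | g in S} for composition of   *)
(* functions is the set S :* s.                                               *)
Definition coset_correspondence (aT : finGroupType) (T : finType)
    (to : {action aT &-> T}) (A : {set aT}) (X : {set T}) (x : T) : Prop :=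
  exists phi : T -> {set aT},
    [/\ {in X &, injective phi},
        phi @: X = rcosets 'C_A[x | to] A
      & {in A, forall s, phi (to x s) = 'C_A[x | to] :* s}].

Definition point : finType := 'I_7.

(* The point labelled k, for 1 <= k <= 7. *)
Definition pt (k : nat) : point := inord k.-1.

Definition fano_lines : {set {set point}} :=
  [set [set pt 1; pt 2; pt 3]; [set pt 1; pt 4; pt 5]; [set pt 1; pt 6; pt 7];
       [set pt 2; pt 4; pt 6]; [set pt 2; pt 5; pt 7]; [set pt 3; pt 4; pt 7];
       [set pt 3; pt 5; pt 6]].

Definition pairs_through (p : point) : {set {set point}} :=
  [set q : {set point} | (p \notin q) && (p |: q \in fano_lines)].

Definition is_ordered_pencil (v : point * {ffun 'I_3 -> {set point}}) : bool :=
  injectiveb v.2 && (v.2 @: [set: 'I_3] == pairs_through v.1).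

Definition pencil : finType :=
  {v : point * {ffun 'I_3 -> {set point}} | is_ordered_pencil v}.

Definition pencil_adj : rel pencil := fun v w =>
  ((val v).1 != (val w).1) &&
  [forall i, #|(val v).2 i :&: (val w).2 i| == 1%N].

Lemma pencil_adj_sym : symmetric pencil_adj.
Proof.
move=> v w; rewrite /pencil_adj eq_sym; congr (_ && _).
by apply: eq_forallb => i; rewrite setIC.
Qed.

Lemma pencil_adj_irr : irreflexive pencil_adj.
Proof. by move=> v; rewrite /pencil_adj eqxx. Qed.

Definition pencil_graph : sgraph := SGraph pencil_adj_sym pencil_adj_irr.

(* Main.v *)
Require Import Defs.
From mathcomp Require Import all_boot all_fingroup ssralg.

Set Implicit Arguments.
Unset Strict Implicit.
Unset Printing Implicit Defensive.

Import GRing.Theory.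

(** Label the points of the Fano plane by the nonzero vectors of F_2^3, writing
    the labels in binary, so that its lines become the nonzero covectors.  An
    ordered pencil v is then a triple of distinct nonzero covectors v_0, v_1, v_2
    with sum zero, and two pencils are adjacent iff their poles differ and they
    agree at some position.  Hence the neighbours of v arise by adding a covector
    w outside {0, v_0, v_1, v_2} to two of its three entries.  The copies of K_4
    consist of v and its three neighbours for a given w, and the copies of
    K_{2,2,2} are the sets of pencils with a given entry at a given position:
    two opposite vertices of an octahedron have four common neighbours, while
    pencils with no common entry have at most three.  Linear maps together with
    permutations of the positions act transitively on the triples formed by v, w
    and an ordering of the positions; this gives ultrahomogeneity and the
    transitivity on edges and vertices.  An automorphism fixing a copy of K_4
    pointwise fixes all neighbours of its vertices, hence everything since the
    graph is connected, so there are 42 * 4! = 1008 automorphisms. *)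

(** * Finite sets and transitive actions *)

Lemma sum_card_members (T : finType) (F : {set {set T}}) :
  \sum_(A in F) #|A| = \sum_x #|[set A in F | x \in A]|.
Proof.
under eq_bigr => A _ do rewrite -sum1_card.
rewrite (exchange_big_dep predT) //=; apply: eq_bigr => x _.
by rewrite -sum1_card; apply: eq_bigl => A; rewrite inE.
Qed.

Lemma exists_notin_seq (T : finType) (A : {set T}) (s : seq T) :
  size s < #|A| -> exists2 x, x \in A & x \notin s.
Proof.
rewrite ltnNge => sA; apply/subsetPn; apply: contra sA => /subset_leq_card.
by move/leq_trans; apply; apply: card_size.
Qed.

Lemma perm_extends_pair (T : finType) (x y x' y' : T) :
  x != y -> x' != y' -> exists s : {perm T}, s x = x' /\ s y = y'.
Proof.
move=> xy xy'; exists (tperm x x' * tperm (tperm x x' y) y')%g.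
have x'N : tperm x x' y != x'.
  by rewrite -[X in _ != X](tpermL x x') (inj_eq perm_inj) eq_sym.
split; rewrite permM ?tpermL //.
by apply: tpermD; rewrite // eq_sym.
Qed.

Lemma exists_ord_imset (T : finType) (A : {set T}) n :
  #|A| = n -> exists2 f : 'I_n -> T, injective f & f @: [set: 'I_n] = A.
Proof.
move=> <-; exists enum_val; first exact: enum_val_inj.
apply/setP=> x; apply/imsetP/idP => [[i _ ->]|xA]; first exact: enum_valP.
by exists (enum_rank_in xA x); rewrite ?enum_rankK_in.
Qed.

Section TransitiveCosets.

Variables (aT : finGroupType) (T : finType) (to : {action aT &-> T}).
Variables (A : {group aT}) (X : {set T}).
Hypothesis trX : [transitive A, on X | to]%g.

Lemma transitive_coset_correspondence x : x \in X -> coset_correspondence to A X x.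
Proof.
move=> xX; have oX := atransP trX _ xX; exists (amove to A x); split.
- by rewrite -oX; apply: can_in_inj (amoveK (subsetT A)).
- by rewrite -oX amove_orbit ?subsetT.
by move=> s sA; rewrite amove_act ?subsetT.
Qed.

Lemma card_transitive_stab x k : x \in X ->
  #|A| = #|X| * k -> #|'C_A[x | to]%g| = k.
Proof.
move=> xX cA; have X0 : 0 < #|X| by apply/card_gt0P; exists x.
apply/eqP; rewrite -(eqn_pmul2l X0) -cA -(card_orbit_stab to A x).
by rewrite (atransP trX _ xX).
Qed.

End TransitiveCosets.

(** * Copies and automorphisms of finite graphs *)

Section Graph.

Variable G : sgraph.

Lemma adj_neq (x y : G) : adj x y -> x != y.
Proof. by apply: contraTneq => ->; rewrite adj_irr. Qed.

Lemma edgesP (e : {set G}) :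
  reflect (exists x y, adj x y /\ e = [set x; y]) (e \in edges G).
Proof.
apply: (iffP imsetP) => [[[x y]]|[x [y [xy ->]]]].
  by rewrite inE => xy ->; exists x, y.
by exists (x, y) => //; rewrite inE.
Qed.

Lemma card_edge (e : {set G}) : e \in edges G -> #|e| = 2.
Proof. by case/edgesP=> x [y [xy ->]]; rewrite cards2 adj_neq. Qed.

Lemma card_edges_at (x : G) :
  #|[set e in edges G | x \in e]| = #|[set y | adj x y]|.
Proof.
rewrite -(card_in_imset (f := fun y => [set x; y])) => [|y z]; last first.
  rewrite !inE => xy _ /setP/(_ y).
  by rewrite !inE eqxx orbT [y == x]eq_sym (negPf (adj_neq xy)) => /esym/eqP.
apply: eq_card => e; rewrite inE; apply/andP/imsetP => [[/edgesP[y [z [yz ->]]]]|].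
  rewrite !inE => /orP[]/eqP->; first by exists z; rewrite ?inE.
  by exists y; rewrite ?inE 1?adj_sym // setUC.
by case=> y; rewrite inE => xy ->; rewrite set21; split=> //; apply/edgesP; exists x, y.
Qed.

Lemma card_edges_regular k :
  (forall x : G, #|[set y | adj x y]| = k) -> #|edges G| * 2 = #|G| * k.
Proof.
move=> degG; rewrite -sum_nat_const (eq_bigr (fun e : {set G} => #|e|)).
  rewrite sum_card_members (eq_bigr (fun=> k)) ?sum_nat_const // => x _.
  by rewrite card_edges_at.
by move=> e /card_edge.
Qed.

Lemma graph_autP (s : {perm G}) :
  reflect (forall x y, adj (s x) (s y) = adj x y) (s \in graph_aut G).
Proof.
rewrite inE; apply: (iffP 'forall_forallP) => sG x y; first exact/eqP.
exact/eqP.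
Qed.

End Graph.

Definition triangle (G : sgraph) (A : {set G}) (x y z : G) : Prop :=
  [/\ [/\ x \in A, y \in A & z \in A], adj x y, adj x z & adj y z].

Lemma copy_iso_triangle (G : sgraph) (A B : {set G}) f x y z :
  copy_iso A B f -> triangle A x y z -> triangle B (f x) (f y) (f z).
Proof.
case=> _ <- f_adj [[xA yA zA] xy xz yz].
by split; [split; apply: imset_f | rewrite f_adj ..].
Qed.

Definition embeddings (H G : sgraph) : {set {ffun H -> G}} :=
  [set f : {ffun H -> G} | injectiveb f &
     [forall x, forall y, adj (f x) (f y) == adj x y]].

Lemma embeddingsP (H G : sgraph) (f : {ffun H -> G}) :
  reflect (injective f /\ forall x y, adj (f x) (f y) = adj x y)
          (f \in embeddings H G).
Proof.
rewrite inE; apply: (iffP andP) => -[/injectiveP f_inj f_adj]; split=> //.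
  by move=> x y; apply/eqP; move/'forall_forallP: f_adj; apply.
by apply/'forall_forallP=> x y; apply/eqP.
Qed.

Definition linear_copies (H G : sgraph) : Prop :=
  {in copies H G &, forall A B : {set G}, A != B -> #|A :&: B| <= 1}.

Definition covering_copies (H G : sgraph) : Prop :=
  {in edges G, forall e : {set G}, exists2 A, A \in copies H G & e \subset A}.

Section Copies.

Variables H G : sgraph.

Lemma copiesP (A : {set G}) :
  reflect (exists2 f, f \in embeddings H G & f @: [set: H] = A) (A \in copies H G).
Proof.
rewrite inE; apply: (iffP existsP) => [[f /and3P[f_inj /eqP<- f_adj]]|[f]].
  by exists f => //; rewrite inE f_inj.
by rewrite inE => /andP[f_inj f_adj] <-; exists f; rewrite f_inj f_adj eqxx.
Qed.

Lemma card_copy (A : {set G}) : A \in copies H G -> #|A| = #|H|.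
Proof. by case/copiesP=> f /embeddingsP[f_inj _] <-; rewrite card_imset // cardsT. Qed.

Lemma card_copies_regular m :
  (forall x : G, #|[set A in copies H G | x \in A]| = m) ->
  #|copies H G| * #|H| = #|G| * m.
Proof.
move=> mG; rewrite -sum_nat_const (eq_bigr (fun A : {set G} => #|A|)).
  by rewrite sum_card_members (eq_bigr (fun=> m)) ?sum_nat_const.
by move=> A /card_copy.
Qed.

Lemma embedding_comp_aut f (s : {perm H}) :
  f \in embeddings H G -> s \in graph_aut H -> [ffun x => f (s x)] \in embeddings H G.
Proof.
move=> /embeddingsP[f_inj f_adj] /graph_autP s_adj; apply/embeddingsP.
by split=> x y; rewrite !ffunE ?f_adj // => /f_inj/perm_inj.
Qed.

Lemma embeddings_same_image f g :
    f \in embeddings H G -> g \in embeddings H G ->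
    g @: [set: H] = f @: [set: H] ->
  exists2 s, s \in graph_aut H & g = [ffun x => f (s x)].
Proof.
move=> /embeddingsP[f_inj f_adj] /embeddingsP[g_inj g_adj] gf.
have /fin_all_exists[h fh] x : exists y, f y = g x.
  have : g x \in f @: [set: H] by rewrite -gf imset_f.
  by case/imsetP=> y _ ->; exists y.
have h_inj : injective h by move=> x y hxy; apply: g_inj; rewrite -!fh hxy.
exists (perm h_inj); last by apply/ffunP=> x; rewrite ffunE permE fh.
by apply/graph_autP=> x y; rewrite !permE -f_adj !fh g_adj.
Qed.

Lemma card_embeddings : #|embeddings H G| = #|copies H G| * #|graph_aut H|.
Proof.
rewrite -sum1_card (partition_big (fun f : {ffun H -> G} => f @: [set: H])
                                  (mem (copies H G))) /= => [|f fE]; last first.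
  by apply/copiesP; exists f.
rewrite -sum_nat_const; apply: eq_bigr => A /copiesP[f fE fA].
have /embeddingsP[f_inj _] := fE.
pose comp_f (s : {perm H}) := [ffun x => f (s x)].
have comp_f_inj : injective comp_f.
  by move=> s t /ffunP st; apply/permP=> x; move: (st x); rewrite !ffunE => /f_inj.
rewrite -(card_imset _ comp_f_inj) sum1dep_card; apply: eq_card => g; rewrite inE -fA.
apply/andP/imsetP => [[gE /eqP/(embeddings_same_image fE gE)[s sH ->]]|[s sH ->]].
  by exists s.
split; first exact: embedding_comp_aut.
apply/eqP/setP=> v; apply/imsetP/imsetP => -[x _ ->].
  by exists (s x); rewrite ?ffunE.
by exists (s^-1 x)%g; rewrite ?ffunE ?permKV.
Qed.

Lemma graph_aut_embedding s f :
  s \in graph_aut G -> f \in embeddings H G -> [ffun x => s (f x)] \in embeddings H G.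
Proof.
move=> /graph_autP s_adj /embeddingsP[f_inj f_adj]; apply/embeddingsP.
by split=> x y; rewrite !ffunE ?s_adj // => /perm_inj/f_inj.
Qed.

Lemma graph_aut_copy (s : {perm G}) A :
  s \in graph_aut G -> A \in copies H G -> s @: A \in copies H G.
Proof.
move=> sG /copiesP[f fE <-]; apply/copiesP; exists [ffun x => s (f x)].
  exact: graph_aut_embedding.
by rewrite -imset_comp; apply: eq_imset => x; rewrite ffunE.
Qed.

(* If a copy of H has trivial pointwise stabilizer, the automorphisms of G *)
(* correspond to the embeddings of H, being determined by their effect on  *)
(* one of them.                                                            *)
Lemma card_graph_aut_rigid A :
    iso_extend H G -> A \in copies H G ->
    (forall s, s \in graph_aut G -> {in A, s =1 id} -> s = 1%g) ->
  #|graph_aut G| = #|copies H G| * #|graph_aut H|.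
Proof.
move=> extH AH rigid; have /copiesP[f fE fA] := AH.
have /embeddingsP[f_inj f_adj] := fE.
pose aut_f (s : {perm G}) := [ffun x => s (f x)].
rewrite -card_embeddings -(card_in_imset (f := aut_f) (D := graph_aut G)); last first.
  move=> s t sG tG /ffunP st; apply/eqP; rewrite eq_mulgV1; apply/eqP/rigid.
    by rewrite groupM ?groupV.
  rewrite -fA => _ /imsetP[x _ ->]; move: (st x).
  by rewrite !ffunE permM => ->; apply: permK.
apply: eq_card => g; apply/imsetP/idP => [[s sG ->]|gE]; first exact: graph_aut_embedding.
have /embeddingsP[g_inj g_adj] := gE.
pose h v := if [pick x | f x == v] is Some x then g x else v.
have hf x : h (f x) = g x.
  by rewrite /h; case: pickP => [y /eqP/f_inj->|/(_ x)/eqP].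
have [||s sG sh] := extH A (g @: [set: H]) h AH; first by apply/copiesP; exists g.
  rewrite -fA; split.
  - by move=> _ _ /imsetP[x _ ->] /imsetP[y _ ->]; rewrite !hf => /g_inj->.
  - by rewrite -imset_comp; apply: eq_imset => x /=; rewrite hf.
  by move=> _ _ /imsetP[x _ ->] /imsetP[y _ ->]; rewrite !hf g_adj f_adj.
by exists s => //; apply/ffunP=> x; rewrite ffunE sh ?hf // -fA imset_f.
Qed.

Hypothesis linear : linear_copies H G.
Hypothesis covering : covering_copies H G.

Lemma edge_in_copies_uniq A B e :
    A \in copies H G -> B \in copies H G -> e \in edges G ->
  e \subset A -> e \subset B -> A = B.
Proof.
move=> AH BH eG eA eB; apply/eqP; apply: contraT => /(linear AH BH).
by rewrite leqNgt -(card_edge eG) subset_leq_card // subsetI eA.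
Qed.

Lemma graph_aut_copy_eq (s : {perm G}) A B x y :
    s \in graph_aut G -> A \in copies H G -> B \in copies H G -> adj x y ->
    x \in A -> y \in A -> s x \in B -> s y \in B ->
  s @: A = B.
Proof.
move=> sG AH BH xy xA yA sxB syB; have e : [set s x; s y] \in edges G.
  by apply/edgesP; exists (s x), (s y); rewrite (graph_autP _ sG).
apply: (edge_in_copies_uniq (graph_aut_copy sG AH) BH e); rewrite subUset !sub1set.
  by rewrite !imset_f.
by rewrite sxB.
Qed.

Lemma card_copies_on_edge e :
  e \in edges G -> #|[set A in copies H G | e \subset A]| = 1.
Proof.
move=> eG; have [A AH eA] := covering eG; apply/eqP/cards1P; exists A.
apply/setP=> B; apply/setIdP/set1P => [[BH eB]|->//].
exact: (edge_in_copies_uniq BH AH eG).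
Qed.

Lemma Hgraph_of_copies n m :
    connected_graph H -> regular_graph H -> 1 < m < n -> connected_graph G ->
    (forall x : G, #|[set A in copies H G | x \in A]| = m) -> #|copies H G| = n ->
  Hgraph H n m G.
Proof.
move=> Hconn Hreg mn Gconn copies_at copiesn; split=> //; split=> // [|x]; last first.
  split=> // A B /setIdP[AH _] /setIdP[BH _]; exact: linear.
exists (copies H G); split=> //.
- move=> A B AH BH; apply: contraR; rewrite -setI_eq0 => /set0Pn[e].
  case/setIP=> /setIdP[eG eA] /setIdP[_ eB].
  exact/eqP/(edge_in_copies_uniq AH BH eG).
- apply/setP=> x; rewrite inE; apply/bigcupP.
  have /card_gt0P[A /setIdP[AH xA]] : 0 < #|[set A in copies H G | x \in A]|.
    by rewrite copies_at; case/andP: mn => /ltnW.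
  by exists A.
apply/setP=> e; apply/bigcupP/idP => [[A _ /setIdP[]] //|eG].
by have [A AH eA] := covering eG; exists A => //; apply/setIdP.
Qed.

End Copies.

(** * Complete and complete multipartite graphs *)

Lemma complete_connected n : 0 < n -> connected_graph (Kcomplete n).
Proof.
move=> n0; split=> [|x y]; first by rewrite card_ord.
by have [->|xy] := eqVneq x y; [apply: connect0 | apply: connect1].
Qed.

Lemma complete_regular n : regular_graph (Kcomplete n).
Proof.
exists n.-1 => x; rewrite -[n in RHS]card_ord -(cardsC1 x).
by apply: eq_card => y; rewrite !inE eq_sym.
Qed.

Lemma card_graph_aut_complete n : #|graph_aut (Kcomplete n)| = n`!.
Proof.
rewrite -card_Sn -cardsT; apply: eq_card => s; rewrite in_setT.
by apply/graph_autP=> x y /=; rewrite (inj_eq perm_inj).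
Qed.

Lemma complete_copyP (G : sgraph) n (A : {set G}) :
  reflect (#|A| = n /\ {in A &, forall x y, x != y -> adj x y})
          (A \in copies (Kcomplete n) G).
Proof.
apply: (iffP idP) => [AK|[/exists_ord_imset[f f_inj <-] f_adj]].
  split; first by rewrite (card_copy AK) card_ord.
  case/copiesP: AK => f /embeddingsP[f_inj f_adj] <- _ _ /imsetP[i _ ->] /imsetP[j _ ->].
  by rewrite f_adj (inj_eq f_inj).
apply/copiesP; exists (finfun f); last by apply: eq_imset => i; rewrite ffunE.
apply/embeddingsP; split=> i j; rewrite !ffunE; first exact: f_inj.
rewrite /=; have [->|ij] := eqVneq i j; first by rewrite adj_irr.
by rewrite f_adj ?imset_f ?(inj_eq f_inj).
Qed.

Lemma multipartite_connected r t : 1 < r -> 0 < t -> connected_graph (Kmultipartite r t).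
Proof.
move=> r1 t0; have r0 : 0 < r by apply: ltnW.
split=> [|x y]; first by rewrite card_prod !card_ord muln_gt0 r0.
have [xy|xy] := eqVneq x.1 y.1; last exact: connect1.
have /card_gt0P[i] : 0 < #|[set~ x.1]| by rewrite cardsC1 card_ord -ltnS prednK.
rewrite !inE => ix; apply: (@connect_trans _ _ (i, Ordinal t0)); apply: connect1.
  by rewrite /= /multipartite_adj eq_sym.
by rewrite /= /multipartite_adj -xy.
Qed.

Lemma multipartite_regular r t : regular_graph (Kmultipartite r t).
Proof.
exists (r.-1 * t) => x.
have -> : [set y : Kmultipartite r t | adj x y] = setX [set~ x.1] [set: 'I_t].
  by apply/setP=> -[i j]; rewrite !inE andbT eq_sym.
by rewrite cardsX cardsC1 cardsT !card_ord.
Qed.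

Lemma multipartite_copy (G : sgraph) (A : {set G}) (T : finType) (part : G -> T) r t :
    #|part @: A| = r ->
    {in part @: A, forall p, #|[set x in A | part x == p]| = t} ->
    {in A &, forall x y, adj x y = (part x != part y)} ->
  A \in copies (Kmultipartite r t) G.
Proof.
move=> /exists_ord_imset[p pI pA] tA adjA.
have /fin_all_exists[f fP] (i : 'I_r) : exists f : 'I_t -> G,
    injective f /\ f @: [set: 'I_t] = [set x in A | part x == p i].
  have [|f f_inj f_imset] := exists_ord_imset (tA (p i) _); first by rewrite -pA imset_f.
  by exists f.
have fA i j : f i j \in A /\ part (f i j) = p i.
  have : f i j \in [set x in A | part x == p i] by rewrite -(fP i).2 imset_f.
  by case/setIdP=> ? /eqP.
apply/copiesP; exists [ffun x => f x.1 x.2].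
  apply/embeddingsP; split=> [[i j] [i' j']|[i j] [i' j']]; rewrite !ffunE /=.
    move=> fij; have /pI ii' : p i = p i' by rewrite -(fA i j).2 fij (fA i' j').2.
    by rewrite -{}ii' in fij *; congr (_, _); apply: (fP i).1.
  by rewrite adjA ?(fA _ _).1 // !(fA _ _).2 (inj_eq pI).
apply/setP=> x; apply/imsetP/idP => [[[i j] _ ->]|xA].
  by rewrite ffunE (fA i j).1.
have /imsetP[i _ xi] : part x \in p @: [set: 'I_r] by rewrite pA imset_f.
have /imsetP[j _ xj] : x \in f i @: [set: 'I_t] by rewrite (fP i).2 inE xA xi eqxx.
by exists (i, j); rewrite ?ffunE.
Qed.

(** * The Fano plane over F_2 *)

Definition vec := (bool * bool * bool)%type.

Section Fano.

Local Open Scope ring_scope.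

Implicit Types (u v w l m : vec) (p q : point).

Lemma addvv u : u + u = 0.
Proof. by case: u => [[[] []] []]. Qed.

Lemma addv_eq0 u v : (u + v == 0) = (u == v).
Proof. by rewrite -(inj_eq (addrI v)) addrCA addvv !addr0. Qed.

Lemma addv_eql u v : (u + v == u) = (v == 0).
Proof. by rewrite -[X in _ == X]addr0 (inj_eq (addrI u)). Qed.

Lemma addvK u v : u + v + v = u.
Proof. by rewrite -addrA addvv addr0. Qed.

Definition dot l u : bool :=
  (l.1.1 && u.1.1) (+) (l.1.2 && u.1.2) (+) (l.2 && u.2).

Lemma dotC l u : dot l u = dot u l.
Proof. by rewrite /dot; congr (_ (+) _ (+) _); apply: andbC. Qed.

Definition binary (n : nat) : vec := (odd n, odd n./2, odd n./2./2).

Definition bits p : vec := binary p.+1.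

Definition line l : {set point} := [set p | ~~ dot l (bits p)].

Lemma in_line0 p : p \in line 0.
Proof. by rewrite inE. Qed.

Lemma in_lineD p l m : (p \in line (l + m)) = ((p \in line l) == (p \in line m)).
Proof.
rewrite !inE; case: (bits p) l m => [[a b] c] [[l1 l2] l3] [[m1 m2] m3].
by rewrite /dot /=; case: a b c l1 l2 l3 m1 m2 m3 => [] [] [] [] [] [] [] [] [].
Qed.

Lemma line_bitsC p q : (p \in line (bits q)) = (q \in line (bits p)).
Proof. by rewrite !inE dotC. Qed.

Lemma card_points (Q : pred vec) :
  #|[set p | Q (bits p)]| = count (Q \o binary) (iota 1 7).
Proof.
rewrite cardsE -sum1_card -(big_mkord (fun n => Q (binary n.+1)) (fun=> 1%N)).
by rewrite sum1_count /index_iota -[1%N]addn0 iotaDl count_map.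
Qed.

Lemma bits_neq0 p : bits p != 0.
Proof. by case: p => [[|[|[|[|[|[|[|]]]]]]]]. Qed.

Lemma bits_inj : injective bits.
Proof.
move=> p q; case: p => [[|[|[|[|[|[|[|//]]]]]]] pP];
  case: q => [[|[|[|[|[|[|[|//]]]]]]] qP] // _; exact: val_inj.
Qed.

Lemma bits_surj u : u != 0 -> exists p, u = bits p.
Proof.
move=> u0; exists (pt (u.1.1 + u.1.2.*2 + u.2.*2.*2)%N).
by move: u u0 => [[[] []] []] // _; rewrite /bits /= inordK.
Qed.

Lemma card_line l : l != 0 -> #|line l| = 3%N.
Proof. by rewrite (card_points (fun u => ~~ dot l u)); case: l => [[[] []] []]. Qed.

Lemma card_lineI l m : #|line l :&: line m| =
  count (fun n => ~~ dot l (binary n) && ~~ dot m (binary n)) (iota 1 7).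
Proof.
rewrite -(card_points (fun u => ~~ dot l u && ~~ dot m u)).
by apply: eq_card => p; rewrite !inE.
Qed.

Lemma card_lineI_neq l m : l != 0 -> m != 0 -> l != m -> #|line l :&: line m| = 1%N.
Proof. by rewrite card_lineI; case: l m => [[[] []] []] [[[] []] []]. Qed.

Lemma lines_meet l m : exists p, p \in line l :&: line m.
Proof.
by apply/card_gt0P; rewrite card_lineI; case: l m => [[[] []] []] [[[] []] []].
Qed.

Lemma line_uniq p q l m : l != 0 -> m != 0 -> p != q ->
  p \in line l -> q \in line l -> p \in line m -> q \in line m -> l = m.
Proof.
move=> l0 m0 pq pl ql pm qm; apply/eqP; apply: contraNT pq => /(card_lineI_neq l0 m0).
move/eqP/cards1P=> [r lm]; have meet x : x \in line l -> x \in line m -> x = r.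
  by move=> xl xm; apply/set1P; rewrite -lm inE xl.
by rewrite (meet p pl pm) (meet q ql qm).
Qed.

Lemma line_inj l m : l != 0 -> m != 0 -> line l = line m -> l = m.
Proof.
move=> l0 m0 lm; apply/eqP; apply: contraT => /(card_lineI_neq l0 m0).
by rewrite lm setIid card_line.
Qed.

Lemma line_through p q : exists2 l, l != 0 & (p \in line l) && (q \in line l).
Proof.
have [r /setIP[pr qr]] := lines_meet (bits p) (bits q).
by exists (bits r); rewrite ?bits_neq0 // !(line_bitsC _ r) pr.
Qed.

Lemma card_lines_through p : #|[set l : vec | (l != 0) && (p \in line l)]| = 3%N.
Proof.
rewrite -(card_line (bits_neq0 p)) -(card_imset _ bits_inj).
apply: eq_card => l; rewrite inE; apply/andP/imsetP => [[/bits_surj[q ->]]|[q qp ->]].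
  by rewrite line_bitsC; exists q.
by rewrite bits_neq0 line_bitsC.
Qed.

Lemma line_of_points i j k l :
    [/\ 0 < i < 8, 0 < j < 8 & 0 < k < 8]%N ->
    all (fun n => ~~ dot l (binary n) == (n \in [:: i; j; k])) (iota 1 7) ->
  [set pt i; pt j; pt k] = line l.
Proof.
have ptE (p : point) n : (0 < n < 8)%N -> (p == pt n) = (p.+1 == n).
  by case: n => // n nP; rewrite -val_eqE /= inordK.
move=> [iP jP kP] /allP lE; apply/setP=> p; rewrite !inE !ptE // -orbA.
have pI : p.+1 \in iota 1 7 by rewrite mem_iota; apply: (ltn_ord p).
by rewrite (eqP (lE _ pI)) !inE.
Qed.

Lemma fano_linesP (A : {set point}) :
  reflect (exists2 l, l != 0 & A = line l) (A \in fano_lines).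
Proof.
have -> : A \in fano_lines = (A \in map line (map binary [:: 4; 2; 6; 1; 5; 3; 7]%N)).
  rewrite /fano_lines (@line_of_points 1 2 3 (binary 4)) //.
  rewrite (@line_of_points 1 4 5 (binary 2)) // (@line_of_points 1 6 7 (binary 6)) //.
  rewrite (@line_of_points 2 4 6 (binary 1)) // (@line_of_points 2 5 7 (binary 5)) //.
  rewrite (@line_of_points 3 4 7 (binary 3)) // (@line_of_points 3 5 6 (binary 7)) //.
  by rewrite !inE -!orbA.
apply: (iffP mapP) => -[l lP ->]; exists l => //; first by apply: contraTneq lP => ->.
by move: lP; case: l => [[[] []] []].
Qed.

End Fano.

(** * Ordered pencils as triples of covectors *)

Section Pencils.

Local Open Scope ring_scope.

Implicit Types (a b w l : vec) (p : point) (u v : pencil_graph) (i j k : 'I_3).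
Implicit Type sigma : {perm 'I_3}.

Lemma ord3_cases i j k : i != j -> k != i -> k != j ->
  forall m, [\/ m = i, m = j | m = k].
Proof.
move=> ij ki kj m; suff: m \in [set i; j; k].
  by rewrite !inE -orbA => /or3P[] /eqP; [apply: Or31 | apply: Or32 | apply: Or33].
suff -> : [set i; j; k] = setT by rewrite inE.
apply/eqP; rewrite eqEcard subsetT cardsT card_ord setUC cardsU1 cards2 !inE.
by rewrite (negPf ki) (negPf kj) ij.
Qed.

Lemma ord3_third i j : i != j -> exists2 k, k != i & k != j.
Proof.
move=> ij; have /card_gt0P[k] : (0 < #|~: [set i; j]|)%N.
  by rewrite cardsCs setCK card_ord cards2 ij.
by rewrite !inE negb_or => /andP[]; exists k.
Qed.

Lemma ord3_other i : exists j, j != i.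
Proof.
have /card_gt0P[j] : (0 < #|[set~ i]|)%N by rewrite cardsC1 card_ord.
by rewrite !inE; exists j.
Qed.

Lemma ord3_others i : exists j k, [/\ j != k, i != j & i != k].
Proof.
have [j ji] := ord3_other i; have [k kj ki] := ord3_third ji.
by exists j, k; rewrite -!(eq_sym _ i) eq_sym.
Qed.

Lemma sum_ord3 (V : nmodType) (f : 'I_3 -> V) i j k :
  i != j -> k != i -> k != j -> \sum_m f m = f i + f j + f k.
Proof.
move=> ij ki kj; rewrite (bigD1 i) // (bigD1 j) 1?eq_sym //=.
rewrite (big_pred1 k) ?addrA // => m.
have [->|->|->] := ord3_cases ij ki kj m; rewrite ?eqxx ?andbF //=.
- by rewrite eq_sym (negPf ki).
- by rewrite eq_sym (negPf kj).
by rewrite ki kj eqxx.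
Qed.

Definition pole v : point := (val v).1.

Definition entry v i : vec :=
  odflt 0 [pick l : vec | (l != 0) && (line l == pole v |: (val v).2 i)].

Lemma entryP v i : entry v i != 0 /\ line (entry v i) = pole v |: (val v).2 i.
Proof.
have : (val v).2 i \in pairs_through (pole v).
  by case/andP: (valP v) => _ /eqP<-; rewrite imset_f.
rewrite inE => /andP[_ /fano_linesP[l l0 lE]]; rewrite /entry.
case: pickP => [m /andP[m0 /eqP] //|/(_ l)]; by rewrite l0 lE eqxx.
Qed.

Lemma entry_neq0 v i : entry v i != 0. Proof. by case: (entryP v i). Qed.

Lemma pole_entry v i : pole v \in line (entry v i).
Proof. by rewrite (entryP v i).2 setU11. Qed.

Lemma pair_entry v i : (val v).2 i = line (entry v i) :\ pole v.
Proof.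
rewrite (entryP v i).2 setU1K //.
have : (val v).2 i \in pairs_through (pole v).
  by case/andP: (valP v) => _ /eqP<-; rewrite imset_f.
by rewrite inE => /andP[].
Qed.

Lemma entry_inj v : injective (entry v).
Proof.
move=> i j vij; case/andP: (valP v) => /injectiveP/(_ i j) + _; apply.
by rewrite !pair_entry vij.
Qed.

Lemma pole_lineP v l :
  reflect (l = 0 \/ exists i, l = entry v i) (pole v \in line l).
Proof.
apply: (iffP idP) => [pl|[->|[i ->]]]; last 2 first.
- exact: in_line0.
- exact: pole_entry.
have [->|l0] := eqVneq l 0; [by left | right].
have lpair : line l :\ pole v \in pairs_through (pole v).
  by rewrite inE setD11 setD1K //; apply/fano_linesP; exists l.
case/andP: (valP v) => _ /eqP vE; move: lpair; rewrite -vE => /imsetP[i _].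
rewrite pair_entry => li; exists i; apply: line_inj => //; first exact: entry_neq0.
by rewrite -(setD1K pl) li setD1K ?pole_entry.
Qed.

Lemma entryD v i j k : i != j -> k != i -> k != j -> entry v i + entry v j = entry v k.
Proof.
move=> ij ki kj; have /pole_lineP[/eqP|[m ijm]] : pole v \in line (entry v i + entry v j).
- by rewrite in_lineD !pole_entry.
- by rewrite addv_eq0 (inj_eq (@entry_inj v)) (negPf ij).
case: (ord3_cases ij ki kj m) ijm => -> // /eqP.
  by rewrite addv_eql (negPf (entry_neq0 v j)).
by rewrite addrC addv_eql (negPf (entry_neq0 v i)).
Qed.

Lemma eq_entry u v i j :
  i != j -> entry u i = entry v i -> entry u j = entry v j -> u = v.
Proof.
move=> ij ui uj; have uv k : entry u k = entry v k.
  have [->|ki] := eqVneq k i; first by [].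
  have [->|kj] := eqVneq k j; first by [].
  by rewrite -!(entryD _ ij ki kj) ui uj.
have pole_u k : pole u \in line (entry v k) by rewrite -uv pole_entry.
have pE : pole u = pole v.
  apply/eqP; apply: contraT => pq.
  have /entry_inj/eqP : entry v i = entry v j.
    exact: (line_uniq (entry_neq0 v i) (entry_neq0 v j) pq (pole_u i)
                      (pole_entry v i) (pole_u j) (pole_entry v j)).
  by rewrite (negPf ij).
apply: val_inj; rewrite [LHS]surjective_pairing [RHS]surjective_pairing.
congr (_, _); first exact: pE.
by apply/ffunP=> k; rewrite !pair_entry uv pE.
Qed.

Lemma sum_entry v : \sum_i entry v i = 0.
Proof.
have [k k0 k1] := @ord3_third ord0 (lift ord0 ord0) isT.
by rewrite (sum_ord3 _ _ k0 k1) // (entryD _ _ k0 k1) // addvv.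
Qed.

Lemma is_ordered_pencil_lines p (f : 'I_3 -> vec) :
    injective f -> (forall i, f i != 0) -> (forall i, p \in line (f i)) ->
  is_ordered_pencil (p, [ffun i => line (f i) :\ p]).
Proof.
move=> f_inj f0 pf; apply/andP; split=> /=.
  apply/injectiveP=> i j; rewrite !ffunE => fij; apply/f_inj/line_inj => //.
  by rewrite -(setD1K (pf i)) fij setD1K.
have f_onto : f @: setT = [set l : vec | (l != 0) && (p \in line l)].
  apply/eqP; rewrite eqEcard card_lines_through card_imset // cardsT card_ord andbT.
  by apply/subsetP=> _ /imsetP[i _ ->]; rewrite inE f0 pf.
apply/eqP/setP=> q; rewrite inE.
apply/imsetP/andP => [[i _ ->]|[pq /fano_linesP[l l0 lE]]].
  by rewrite ffunE setD11 setD1K //; split=> //; apply/fano_linesP; exists (f i).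
have /imsetP[i _ lf] : l \in f @: setT by rewrite f_onto inE l0 -lE setU11.
by exists i; rewrite ?in_setT // ffunE -lf -lE setU1K.
Qed.

Lemma pencil_exists (f : 'I_3 -> vec) :
  (forall i, f i != 0) -> \sum_i f i = 0 -> exists v, forall i, entry v i = f i.
Proof.
move=> f0 f_sum.
have fD i j k : i != j -> k != i -> k != j -> f i + f j = f k.
  by move=> ij ki kj; apply/eqP; rewrite -addv_eq0 -(sum_ord3 f ij ki kj) f_sum.
have f_inj : injective f.
  move=> i j fij; apply/eqP; apply: contraT => ij; have [k ki kj] := ord3_third ij.
  by have /eqP := f0 k; rewrite -(fD _ _ _ ij ki kj) fij addvv.
have [p pf] : exists p, forall i, p \in line (f i).
  have [p /setIP[p0 p1]] := lines_meet (f ord0) (f (lift ord0 ord0)); exists p => k.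
  have [->//|k0] := eqVneq k ord0; have [->//|k1] := eqVneq k (lift ord0 ord0).
  by rewrite -(fD _ _ _ _ k0 k1) // in_lineD p0 p1.
exists (Sub _ (is_ordered_pencil_lines f_inj f0 pf) : pencil) => i.
apply: line_inj => //; first exact: entry_neq0.
by rewrite (entryP _ i).2 /pole !SubK /= ffunE setD1K.
Qed.

Lemma pencil_exists2 i j a b : i != j -> a != 0 -> b != 0 -> a != b ->
  exists v, entry v i = a /\ entry v j = b.
Proof.
move=> ij a0 b0 ab; have [k ki kj] := ord3_third ij.
pose f m := if m == i then a else if m == j then b else a + b.
have fj : f j = b by rewrite /f eq_sym (negPf ij) eqxx.
have [||v vE] := @pencil_exists f.
- by move=> m; rewrite /f; do 2?case: ifP => _ //; rewrite addv_eq0.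
- rewrite (sum_ord3 _ ij ki kj) fj {1}/f eqxx.
  by rewrite /f (negPf ki) (negPf kj) addvv.
by exists v; rewrite !vE fj /f eqxx.
Qed.

Lemma mem_line_entry u p i j :
  p != pole u -> p \in line (entry u i) -> (p \in line (entry u j)) = (j == i).
Proof.
move=> pu pi; apply/idP/eqP => [pj|->//]; apply: entry_inj.
exact: (line_uniq (entry_neq0 u j) (entry_neq0 u i) pu pj (pole_entry u j)
                  pi (pole_entry u i)).
Qed.

(* The covector entry u i = entry v j is that of the line joining the two poles. *)
Lemma card_pairI u v i j k : pole u != pole v -> entry u i = entry v j ->
  (#|(val u).2 k :&: (val v).2 k| == 1)%N = ((k == i) == (k == j)).
Proof.
move=> uv uivj; set a := entry u k; set b := entry v k.
have pv : (pole u \in line b) = (k == j).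
  by apply: mem_line_entry => //; rewrite -uivj pole_entry.
have pu : (pole v \in line a) = (k == i).
  by apply: mem_line_entry; [rewrite eq_sym | rewrite uivj pole_entry].
have cardI : #|line a :&: line b| = if (k == i) && (k == j) then 3%N else 1%N.
  have [ab|ab] := eqVneq a b.
    by rewrite -pu -pv -ab setIid card_line ?entry_neq0 // {1}ab /a /b !pole_entry.
  rewrite card_lineI_neq ?entry_neq0 //; case: andP => // -[/eqP ki /eqP kj].
  by rewrite /a /b ki {1}uivj -ki kj eqxx in ab.
have -> : (val u).2 k :&: (val v).2 k = (line a :&: line b) :\ pole u :\ pole v.
  apply/setP=> p; rewrite !pair_entry !in_setI !in_setD1 in_setI.
  by case: (p == pole u); case: (p == pole v); rewrite //= andbF.
have := cardsD1 (pole u) (line a :&: line b).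
rewrite cardI (cardsD1 (pole v) (_ :\ _)) in_setD1 !in_setI pole_entry pv pu.
rewrite [pole v == _]eq_sym uv pole_entry andbT /=.
by case: (k == i); case: (k == j); case: #|_| => [|[]].
Qed.

Lemma adj_pencilE u v :
  adj u v = (pole u != pole v) && [exists i, entry u i == entry v i].
Proof.
rewrite /adj /= /pencil_adj -/(pole u) -/(pole v).
have [//|uv /=] := eqVneq (pole u) (pole v).
have [l l0 /andP[ul vl]] := line_through (pole u) (pole v).
have [i li] : exists i, l = entry u i by case/pole_lineP: ul l0 => // ->; rewrite eqxx.
have [j lj] : exists j, l = entry v j by case/pole_lineP: vl l0 => // ->; rewrite eqxx.
rewrite li in lj; have pairI k := card_pairI k uv lj.
apply/forallP/existsP => [all_meet|[k /eqP uvk] m].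
  exists i; have := all_meet i; rewrite pairI eqxx lj (inj_eq (@entry_inj v)).
  by rewrite [j == i]eq_sym => /eqP<-.
have /eqP ki : k == i.
  have vi : pole v \in line (entry u i) by rewrite lj pole_entry.
  by rewrite -(mem_line_entry k _ vi) 1?eq_sym // uvk pole_entry.
have /eqP kj : k == j by rewrite -(inj_eq (@entry_inj v)) -uvk ki lj.
by rewrite pairI -ki -kj.
Qed.

(* Failed unifications between entries of two pencils would otherwise unfold *)
(* them down to the search through vec.                                       *)
Opaque entry pole line.

(** * Neighbourhoods of ordered pencils *)

Lemma pole_on_two_entries v p i j :
  i != j -> p \in line (entry v i) -> p \in line (entry v j) -> p = pole v.
Proof.
move=> ij pi pj; apply/eqP; apply: contraT => pv.
by rewrite -(mem_line_entry i pv pj) pi in ij.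
Qed.

Definition missing v : {set vec} := [set w | pole v \notin line w].

Lemma in_missing v w : (w \in missing v) = (pole v \notin line w).
Proof. by rewrite inE. Qed.

Lemma missingPn v w : reflect (w = 0 \/ exists i, w = entry v i) (w \notin missing v).
Proof. by rewrite in_missing negbK; apply: pole_lineP. Qed.

Lemma entry_notin_missing v i : entry v i \notin missing v.
Proof. by apply/missingPn; right; exists i. Qed.

Lemma missing_neq0 v w : w \in missing v -> w != 0.
Proof. by apply: contraTneq => ->; apply/missingPn; left. Qed.

Lemma missingDr v w l : l \notin missing v -> (w + l \in missing v) = (w \in missing v).
Proof. by rewrite !in_missing negbK in_lineD => ->; rewrite eqb_id. Qed.

Lemma missing_entryD v i w : (entry v i + w \in missing v) = (w \in missing v).
Proof. by rewrite addrC missingDr // entry_notin_missing. Qed.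

Lemma missingD v w x : w \in missing v -> x \in missing v -> w + x \notin missing v.
Proof. by rewrite !in_missing negbK in_lineD => /negPf-> /negPf->. Qed.

Lemma missing_sum_entry v i w x : w \in missing v -> x \in missing v ->
  w != x -> w + x != entry v i -> exists2 j, j != i & w + x = entry v j.
Proof.
move=> wv xv wx wxi; have /missingPn[/eqP|[j wxj]] := missingD wv xv.
  by rewrite addv_eq0 (negPf wx).
by exists j => //; apply: contraNneq wxi => <-; rewrite wxj.
Qed.

Lemma card_missing v : #|missing v| = 4%N.
Proof.
have missingC : ~: missing v = (0 : vec) |: entry v @: [set: 'I_3].
  apply/setP=> l; rewrite in_setC; apply/missingPn/setU1P => -[->|lv]; try by left.
    by right; case: lv => i ->; rewrite imset_f.
  by right; case/imsetP: lv => i _ ->; exists i.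
rewrite cardsCs missingC cardsU1 card_imset; last exact: entry_inj.
rewrite cardsT card_ord !card_prod !card_bool; case: imsetP => // -[i _ /esym/eqP].
by rewrite (negPf (entry_neq0 v i)).
Qed.

Lemma exists_missing v : exists w, w \in missing v.
Proof. by apply/card_gt0P; rewrite card_missing. Qed.

Lemma neq_poleP u v : reflect (exists i, entry u i \in missing v) (pole u != pole v).
Proof.
apply: (iffP idP) => [|[i]]; last first.
  by rewrite in_missing; apply: contraNneq => <-; rewrite pole_entry.
move=> uv; apply/existsP; apply: contraT; rewrite negb_exists => /forallP none_missing.
have on_entry i : pole v \in line (entry u i).
  by have := none_missing i; rewrite in_missing negbK.
case/eqP: uv; apply/esym.
exact: (pole_on_two_entries (i := ord0) (j := lift ord0 ord0)).
Qed.

Definition shift v i w : pencil_graph :=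
  odflt v [pick u | [forall j, entry u j == entry v j + if j == i then 0 else w]].

Lemma entry_shiftE v i w j :
  w \in missing v -> entry (shift v i w) j = entry v j + if j == i then 0 else w.
Proof.
move=> wv; have [||u uE] := @pencil_exists (fun j => entry v j + if j == i then 0 else w).
- move=> k; case: ifP => _; first by rewrite addr0 entry_neq0.
  by apply: (@missing_neq0 v); rewrite missing_entryD.
- rewrite big_split /= sum_entry add0r (bigD1 i) //= eqxx add0r.
  rewrite (eq_bigr (fun=> w)) => [|k /negPf-> //].
  by rewrite big_const cardC1 card_ord /= addr0 addvv.
rewrite /shift; case: pickP => [u' /forallP/(_ j)/eqP //|/(_ u)/forallP[k]].
exact/eqP.
Qed.

Lemma entry_shift_id v i w : w \in missing v -> entry (shift v i w) i = entry v i.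
Proof. by move=> wv; rewrite entry_shiftE // eqxx addr0. Qed.

Lemma entry_shift v i w j :
  w \in missing v -> j != i -> entry (shift v i w) j = entry v j + w.
Proof. by move=> wv /negPf ji; rewrite entry_shiftE // ji. Qed.

Lemma adj_pencilP u v :
  reflect ((exists i, entry u i = entry v i) /\ exists i, entry u i \in missing v)
          (adj u v).
Proof.
by rewrite adj_pencilE andbC; apply: (iffP andP) => -[/exists_eqP uv /neq_poleP uNv].
Qed.

Lemma adj_common_entry u v : adj u v -> exists i, entry u i = entry v i.
Proof. by case/adj_pencilP. Qed.

Lemma adj_entries_uniq u v i j : adj u v -> pole u \in line (entry v i) ->
  pole u \in line (entry v j) -> i = j.
Proof.
rewrite adj_pencilE => /andP[uv _] ui uj; apply/eqP; apply: contraT => ij.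
by rewrite (pole_on_two_entries ij ui uj) eqxx in uv.
Qed.

Lemma adj_shiftP v u :
  reflect (exists i w, w \in missing v /\ u = shift v i w) (adj v u).
Proof.
rewrite adj_sym; apply: (iffP (adj_pencilP u v)) => [[[i ui] [j uj]]|[i [w [wv ->]]]].
  have ji : j != i by apply: contraTneq uj => ->; rewrite ui entry_notin_missing.
  have wv : entry v j + entry u j \in missing v by rewrite missing_entryD.
  exists i, (entry v j + entry u j); split=> //.
  apply: (eq_entry ji); first by rewrite entry_shift // addrA addvv add0r.
  by rewrite entry_shift_id.
split; first by exists i; rewrite entry_shift_id.
by have [j ji] := ord3_other i; exists j; rewrite entry_shift // missing_entryD.
Qed.

Lemma adj_self_shift v i w : w \in missing v -> adj v (shift v i w).
Proof. by move=> wv; apply/adj_shiftP; exists i, w. Qed.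

Lemma shift_eq v i j w x : w \in missing v -> x \in missing v ->
  (shift v i w == shift v j x) = (i == j) && (w == x).
Proof.
move=> wv xv; apply/eqP/andP => [wx|[/eqP-> /eqP->] //].
have ij : i = j.
  apply/eqP; apply: contraT => ij; have := entry_shift_id i wv.
  by rewrite wx entry_shift // => /eqP; rewrite addv_eql (negPf (missing_neq0 xv)).
rewrite ij eqxx; split=> //; have [k kj] := ord3_other j.
by have := entry_shift wv kj; rewrite -{1}ij wx entry_shift // => /addrI->.
Qed.

Lemma missing_shift v i w : w \in missing v -> w \in missing (shift v i w).
Proof.
move=> wv; set u := shift v i w; rewrite in_missing; apply/negP=> uw.
have [j ji] := ord3_other i.
have ui : pole u \in line (entry v i) by rewrite -(entry_shift_id i wv) pole_entry.
have uj : pole u \in line (entry v j).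
  by have := pole_entry u j; rewrite entry_shift // in_lineD uw eqb_id.
by move: wv; rewrite in_missing -(pole_on_two_entries ji uj ui) uw.
Qed.

Lemma adj_shift_same v i w x : w \in missing v -> x \in missing v ->
  adj (shift v i w) (shift v i x) = (w != x) && (w + x != entry v i).
Proof.
move=> wv xv; apply/idP/andP => [ux|[wx wxi]].
  split; first by apply: contraTneq ux => ->; rewrite adj_irr.
  apply: contraTneq ux => wxi; apply/adj_pencilP => -[_ [m]]; apply/negP.
  have xi := entry_notin_missing (shift v i x) i; rewrite entry_shift_id // in xi.
  have [->|mi] := eqVneq m i; first by rewrite entry_shift_id.
  rewrite entry_shift // -(missingDr _ xi) -wxi addrA addvK -(entry_shift xv mi).
  exact: entry_notin_missing.
have [m mi wxm] := missing_sum_entry wv xv wx wxi.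
apply/adj_pencilP; split; first by exists i; rewrite !entry_shift_id.
by exists m; rewrite entry_shift // -wxm addrC addrA addvv add0r missing_shift.
Qed.

Lemma adj_shift_diff v i j w x : w \in missing v -> x \in missing v -> i != j ->
  adj (shift v i w) (shift v j x) = (w == x).
Proof.
move=> wv xv ij; have [k ki kj] := ord3_third ij.
apply/adj_pencilP/eqP => [[[m +] _]|<-].
  rewrite !entry_shiftE // => /addrI.
  have [->|mi] := eqVneq m i.
    by rewrite (negPf ij) => /eqP; rewrite eq_sym (negPf (missing_neq0 xv)).
  by case: eqP => // _ /eqP; rewrite (negPf (missing_neq0 wv)).
split; first by exists k; rewrite !entry_shift.
exists j; rewrite entry_shift // 1?eq_sym // -{1}(entry_shift_id j wv).
by rewrite missing_entryD missing_shift.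
Qed.

Lemma card_neighbours v : #|[set u | adj v u]| = 12%N.
Proof.
have -> : [set u | adj v u] = [set shift v x.1 x.2 | x in setX [set: 'I_3] (missing v)].
  apply/setP=> u; rewrite inE; apply/adj_shiftP/imsetP => [[i [w [wv ->]]]|[[i w]]].
    by exists (i, w); rewrite ?in_setX ?in_setT.
  by rewrite in_setX => /andP[_ wv] ->; exists i, w.
rewrite card_in_imset; first by rewrite cardsX cardsT card_ord card_missing.
move=> [i w] [j x]; rewrite !in_setX => /andP[_ wv] /andP[_ xv] /eqP.
by rewrite /= shift_eq // => /andP[/eqP-> /eqP->].
Qed.

(** * The tetrahedra of the pencil graph *)

Definition tetra v w : {set pencil_graph} := v |: [set shift v i w | i : 'I_3].

Lemma tetraP v w u : reflect (u = v \/ exists i, u = shift v i w) (u \in tetra v w).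
Proof.
apply: (iffP setU1P) => -[->|]; try by left.
  by case/imsetP=> i _ ->; right; exists i.
by case=> i ->; right; apply/imsetP; exists i.
Qed.

Lemma shift_tetra v i w : shift v i w \in tetra v w.
Proof. by apply/tetraP; right; exists i. Qed.

Lemma tetra_self v w : v \in tetra v w.
Proof. by apply/tetraP; left. Qed.

Lemma tetra_copy v w : w \in missing v -> tetra v w \in copies K4 pencil_graph.
Proof.
move=> wv; have adj_shifts i j : i != j -> adj (shift v i w) (shift v j w).
  by move=> ij; rewrite adj_shift_diff.
apply/complete_copyP; split.
  rewrite cardsU1 card_imset => [|i j /eqP]; last first.
    by rewrite shift_eq // eqxx andbT => /eqP.
  rewrite card_ord; case: imsetP => // -[i _ vi].
  by have := adj_self_shift i wv; rewrite -vi adj_irr.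
move=> _ _ /tetraP[->|[i ->]] /tetraP[->|[j ->]]; rewrite ?eqxx //.
- by rewrite adj_self_shift.
- by rewrite adj_sym adj_self_shift.
by rewrite shift_eq // eqxx andbT => /adj_shifts.
Qed.

(* Otherwise the fourth vertex of A is some shift v i z, and w + x and w + z are *)
(* the entries of v at the two positions other than i.  Then x + z = entry v i,  *)
(* so shift v i x and shift v i z are not adjacent.                              *)
Lemma K4_copy_shift_inj v i (A : {set pencil_graph}) w x :
    A \in copies K4 pencil_graph -> v \in A -> w \in missing v -> x \in missing v ->
  shift v i w \in A -> shift v i x \in A -> w = x.
Proof.
move=> /complete_copyP[cardA cliqueA] vA wv xv vwA vxA; apply/eqP; apply: contraT => wNx.
have wx : adj (shift v i w) (shift v i x) by rewrite cliqueA // shift_eq // eqxx.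
have [|y yA] := @exists_notin_seq _ A [:: v; shift v i w; shift v i x].
  by rewrite cardA.
rewrite !inE !negb_or => /and3P[yv yw yx].
have {yv} /adj_shiftP[j [z [zv yE]]] : adj v y by rewrite cliqueA // eq_sym.
have wz : adj (shift v i w) (shift v j z) by rewrite -yE cliqueA // eq_sym.
have xz : adj (shift v i x) (shift v j z) by rewrite -yE cliqueA // eq_sym.
have [ij|ij] := eqVneq i j; last first.
  by move: wz xz wx; rewrite 2?adj_shift_diff // => /eqP-> /eqP->; rewrite adj_irr.
move: wz xz wx; rewrite -{j yE}ij !adj_shift_same //.
move=> /andP[wz wzi] /andP[xz xzi] /andP[wx wxi].
have [m mi wxm] := missing_sum_entry wv xv wx wxi.
have [n ni wzn] := missing_sum_entry wv zv wz wzi.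
have nm : n != m.
  by apply: contraNneq xz => nm; rewrite -(inj_eq (addrI w)) wxm wzn nm.
case/negP: xzi; rewrite -(@entryD v m n i) 1?eq_sym // -wxm -wzn.
by rewrite addrACA addvv add0r.
Qed.

Lemma K4_copy_tetra v (A : {set pencil_graph}) :
    A \in copies K4 pencil_graph -> v \in A ->
  exists2 w, w \in missing v & A = tetra v w.
Proof.
move=> AK vA; have /complete_copyP[cardA cliqueA] := AK.
have in_shift u : u \in A -> u != v -> exists i w, w \in missing v /\ u = shift v i w.
  by move=> uA uv; apply/adj_shiftP/cliqueA => //; rewrite eq_sym.
have [|u uA] := @exists_notin_seq _ A [:: v]; first by rewrite cardA.
rewrite mem_seq1 => uv; have [i [w [wv uE]]] := in_shift u uA uv; exists w => //.
apply/eqP; rewrite eqEcard (card_copy AK) (card_copy (tetra_copy wv)) leqnn andbT.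
apply/subsetP=> t tA; have [->|tv] := eqVneq t v; first exact: tetra_self.
have [j [x [xv tE]]] := in_shift t tA tv.
suff -> : t = shift v j w by apply: shift_tetra.
rewrite tE; have [ij|ij] := eqVneq i j.
  by congr shift; apply: (K4_copy_shift_inj (i := j) AK vA); rewrite -?tE // -ij -uE.
have : adj u t by rewrite cliqueA // uE tE shift_eq // (negPf ij).
by rewrite uE tE adj_shift_diff // => /eqP->.
Qed.

Lemma tetra_inj v : {in missing v &, injective (tetra v)}.
Proof.
move=> w x wv xv wx; have : shift v ord0 w \in tetra v x by rewrite -wx shift_tetra.
case/tetraP=> [vE|[j /eqP]]; last by rewrite shift_eq // => /andP[_ /eqP].
by have := adj_self_shift ord0 wv; rewrite vE adj_irr.
Qed.

Lemma card_K4_copies_at v : #|[set A in copies K4 pencil_graph | v \in A]| = 4%N.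
Proof.
rewrite -(card_missing v) -(card_in_imset (@tetra_inj v)); apply: eq_card => A.
apply/setIdP/imsetP => [[AK vA]|[w wv ->]]; first exact: K4_copy_tetra.
by rewrite tetra_copy ?tetra_self.
Qed.

Lemma linear_K4_copies : linear_copies K4 pencil_graph.
Proof.
move=> A B AK BK; apply: contraNT; rewrite -ltnNge => /card_gt1P[v [u []]].
move=> /setIP[vA vB] /setIP[uA uB] vu.
have [w wv AE] := K4_copy_tetra AK vA.
have [x xv BE] := K4_copy_tetra BK vB.
move: uA uB; rewrite AE BE => /tetraP[uv|[i ->]]; first by rewrite uv eqxx in vu.
case/tetraP=> [vE|[j /eqP]]; last by rewrite shift_eq // => /andP[_ /eqP->].
by have := adj_self_shift i wv; rewrite vE adj_irr.
Qed.

Lemma covering_K4_copies : covering_copies K4 pencil_graph.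
Proof.
move=> _ /edgesP[v [_ [/adj_shiftP[i [w [wv ->]]] ->]]]; exists (tetra v w).
  exact: tetra_copy.
by rewrite subUset !sub1set tetra_self shift_tetra.
Qed.

(** * The octahedra of the pencil graph *)

Definition octa i a : {set pencil_graph} := [set v | entry v i == a].

Lemma mem_octa v i a : (v \in octa i a) = (entry v i == a).
Proof. by rewrite inE. Qed.

Lemma octa_adj i a : {in octa i a &, forall u v, adj u v = (pole u != pole v)}.
Proof.
move=> u v; rewrite !inE => /eqP ui /eqP vi; rewrite adj_pencilE.
suff -> : [exists k, entry u k == entry v k] by rewrite andbT.
by apply/existsP; exists i; rewrite ui vi.
Qed.

Lemma imset_pole_octa i a : a != 0 -> pole @: octa i a = line a.
Proof.
move=> a0; apply/setP=> p; apply/imsetP/idP => [[v + ->]|pa].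
  by rewrite inE => /eqP<-; apply: pole_entry.
have [|b] := @exists_notin_seq _ [set l : vec | (l != 0) && (p \in line l)] [:: a].
  by rewrite card_lines_through.
rewrite in_set mem_seq1 [b == a]eq_sym => /andP[b0 pb] ab.
have [j ji] := ord3_other i; rewrite eq_sym in ji.
have [v [vi vj]] := pencil_exists2 ji a0 b0 ab; exists v; first by rewrite inE vi.
by apply: (pole_on_two_entries ji); rewrite ?vi ?vj.
Qed.

Lemma antipode_exists v i j k : j != k -> i != j -> i != k ->
  exists u, [/\ entry u i = entry v i, entry u j = entry v k & entry u k = entry v j].
Proof.
move=> jk ij ik.
have [|u [uj uk]] := pencil_exists2 jk (entry_neq0 v k) (entry_neq0 v j).
  by rewrite (inj_eq (@entry_inj v)) eq_sym.
by exists u; split=> //; rewrite -(entryD u jk ij ik) uj uk addrC (entryD v jk ij ik).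
Qed.

Lemma same_pole_cases u v i j k : j != k -> i != j -> i != k ->
    pole u = pole v -> entry u i = entry v i ->
  entry u j = entry v j \/ entry u j = entry v k.
Proof.
move=> jk ij ik uv ui; have := pole_entry u j; rewrite uv => /pole_lineP[/eqP|[m uj]].
  by rewrite (negPf (entry_neq0 u j)).
case: (ord3_cases jk ij ik m) uj => ->; [by left | by right |].
by rewrite -ui => /entry_inj/eqP; rewrite eq_sym (negPf ij).
Qed.

Lemma card_octa_pole i a p : a != 0 -> p \in line a ->
  #|[set v in octa i a | pole v == p]| = 2%N.
Proof.
move=> a0; rewrite -(imset_pole_octa i a0) => /imsetP[v]; rewrite inE => /eqP vi ->.
have [j [k [jk ij ik]]] := ord3_others i.
have [u [ui uj uk]] := antipode_exists v jk ij ik.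
have -> : [set x in octa i a | pole x == pole v] = [set v; u].
  apply/setP=> x; rewrite !inE; apply/andP/orP => [[/eqP xi /eqP xv]|[]/eqP->].
  - have [xj|xj] := same_pole_cases jk ij ik xv (etrans xi (esym vi)).
      by left; apply/eqP/(eq_entry ij); rewrite ?xi.
    by right; apply/eqP/(eq_entry ij); rewrite ?xi ?ui ?xj.
  - by rewrite vi.
  rewrite ui vi; split=> //; apply/eqP; apply: (pole_on_two_entries jk).
    by rewrite -uk pole_entry.
  by rewrite -uj pole_entry.
rewrite cards2; case: eqVneq => // vu.
by move: uj => /eqP; rewrite -vu (inj_eq (@entry_inj v)) (negPf jk).
Qed.

Lemma octa_copy i a : a != 0 -> octa i a \in copies K222 pencil_graph.
Proof.
move=> a0; apply: (multipartite_copy (part := pole)); last exact: octa_adj.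
  by rewrite imset_pole_octa // card_line.
by rewrite imset_pole_octa // => p; apply: card_octa_pole.
Qed.

Lemma card_octa i a : a != 0 -> #|octa i a| = 6%N.
Proof. by move=> /(octa_copy i)/card_copy; rewrite card_prod !card_ord. Qed.

Lemma common_neighbour_octa x y z i : x != y -> ~~ adj x y -> entry x i = entry y i ->
  adj x z -> adj y z -> z \in octa i (entry x i).
Proof.
move=> xy xNy xyi xz yz.
have pE : pole x = pole y.
  apply/eqP; apply: contraNT xNy => pxy; rewrite adj_pencilE pxy.
  by apply/existsP; exists i; rewrite xyi.
have [m xm] := adj_common_entry xz; have [n yn] := adj_common_entry yz.
have mn : m = n.
  apply: (adj_entries_uniq xz); first by rewrite -xm pole_entry.
  by rewrite pE -yn pole_entry.
rewrite inE; have [->|im] := eqVneq i m; first by rewrite xm.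
case/eqP: xy; apply: (eq_entry im) => //.
by rewrite xm mn -yn.
Qed.

(* A common neighbour z is determined by the positions m and n at which it agrees *)
(* with x and with y.  If entry x k = entry y h is the line joining the poles,    *)
(* then m != k, n != h and m != n, which leaves three pairs (m, n).               *)
Lemma card_common_neighbours x y : (forall i, entry x i != entry y i) ->
  (#|[set z | adj x z & adj y z]| <= 3)%N.
Proof.
move=> xNy; have [l l0 /andP[xl yl]] := line_through (pole x) (pole y).
have [k lk] : exists k, l = entry x k by case/pole_lineP: xl l0 => // ->; rewrite eqxx.
have [h lh] : exists h, l = entry y h by case/pole_lineP: yl l0 => // ->; rewrite eqxx.
have kh : k != h by apply: contraNneq (xNy k) => kh; rewrite -lk kh -lh.
have [o ok oh] := ord3_third kh.
pose B := setX [set~ k] [set~ h] :\ (o, o).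
have cardB : #|B| = 3%N.
  have := cardsD1 (o, o) (setX [set~ k] [set~ h]).
  by rewrite cardsX !cardsC1 card_ord !inE ok oh => -[].
pose f mn := odflt x
  [pick z | (entry z mn.1 == entry x mn.1) && (entry z mn.2 == entry y mn.2)].
suff /subset_leq_card/leq_trans : [set z | adj x z & adj y z] \subset f @: B.
  by apply; rewrite (leq_trans (leq_imset_card _ _)) ?cardB.
apply/subsetP=> z; rewrite inE => /andP[xz yz].
have [m xm] := adj_common_entry xz; have [n yn] := adj_common_entry yz.
have mn : m != n by apply: contraNneq (xNy m) => mn; rewrite xm mn yn.
apply/imsetP; exists (m, n).
  rewrite !inE xpair_eqE /=; apply/and3P; split.
  - by apply: contra mn => /andP[/eqP-> /eqP->].
  - apply: contra mn => /eqP mk; apply/eqP/(adj_entries_uniq yz).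
      by rewrite -xm mk -lk.
    by rewrite -yn pole_entry.
  apply: contra mn => /eqP nh; apply/eqP/(adj_entries_uniq xz).
    by rewrite -xm pole_entry.
  by rewrite -yn nh -lh.
rewrite /f; case: pickP => [z' /andP[/eqP z'm /eqP z'n]|/(_ z)]; last first.
  by rewrite /= xm yn !eqxx.
by apply: (eq_entry mn); rewrite /= in z'm z'n *; rewrite ?z'm ?z'n.
Qed.

Lemma K222_copyP (A : {set pencil_graph}) :
  reflect (exists i a, a != 0 /\ A = octa i a) (A \in copies K222 pencil_graph).
Proof.
apply: (iffP idP) => [AK|[i [a [a0 ->]]]]; last exact: octa_copy.
have cardA : #|A| = 6%N by rewrite (card_copy AK) card_prod !card_ord.
case/copiesP: AK => f /embeddingsP[f_inj f_adj] fA.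
pose x := f (ord0, ord0); pose y := f (ord0, lift ord0 ord0).
have xNy : ~~ adj x y by rewrite f_adj.
have xy : x != y by rewrite (inj_eq f_inj).
have commonA : A :\ x :\ y \subset [set z | adj x z & adj y z].
  rewrite -fA; apply/subsetP=> z /setD1P[zy /setD1P[zx /imsetP[[m n] _ zE]]].
  rewrite inE zE !f_adj /= /multipartite_adj /= eq_sym andbb.
  apply: contraNneq zx => m0; move: zy; rewrite zE m0 !(inj_eq f_inj) xpair_eqE eqxx /=.
  by rewrite xpair_eqE eqxx; case: n {zE} => [[|[|//]] ?].
have [i /eqP xyi] : exists i, entry x i == entry y i.
  apply/existsP; apply: contraT; rewrite negb_exists => /forallP/card_common_neighbours.
  rewrite leqNgt (leq_trans _ (subset_leq_card commonA)) //.
  have [xA yA] : x \in A /\ y \in A by rewrite -fA !imset_f.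
  move: cardA; rewrite (cardsD1 x) (cardsD1 y) in_setD1 xA yA eq_sym xy !add1n.
  by case=> ->.
exists i, (entry x i); split; first exact: entry_neq0.
apply/eqP; rewrite eqEcard cardA card_octa ?entry_neq0 // andbT; apply/subsetP=> z zA.
have [->|zx] := eqVneq z x; first by rewrite inE.
have [->|zy] := eqVneq z y; first by rewrite inE xyi.
have := subsetP commonA z; rewrite !inE zx zy zA => /(_ isT)/andP[xz yz].
by have := common_neighbour_octa xy xNy xyi xz yz; rewrite inE.
Qed.

Lemma octa_entry_inj v : injective (fun i => octa i (entry v i)).
Proof.
move=> i j octaE; apply/eqP; apply: contraT; rewrite eq_sym => ji.
have [w wv] := exists_missing v.
have : shift v i w \in octa j (entry v j) by rewrite -octaE mem_octa entry_shift_id.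
by rewrite mem_octa entry_shift // addv_eql (negPf (missing_neq0 wv)).
Qed.

Lemma K222_copies_at v :
  [set A in copies K222 pencil_graph | v \in A] = [set octa i (entry v i) | i : 'I_3].
Proof.
apply/setP=> A; apply/setIdP/imsetP => [[/K222_copyP[i [a [_ ->]]]]|[i _ ->]].
  by rewrite mem_octa => /eqP<-; exists i.
by rewrite mem_octa octa_copy ?entry_neq0.
Qed.

Lemma card_K222_copies_at v : #|[set A in copies K222 pencil_graph | v \in A]| = 3%N.
Proof. by rewrite K222_copies_at card_imset ?card_ord //; apply: octa_entry_inj. Qed.

Lemma octa_inj :
  {in setX [set: 'I_3] [set~ (0 : vec)] &, injective (fun x => octa x.1 x.2)}.
Proof.
move=> [i a] [j b]; rewrite !in_setX !inE /= => a0 b0 octaE.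
have /card_gt0P[v] : (0 < #|octa i a|)%N by rewrite card_octa.
move=> vA; have vB := vA; rewrite octaE in vB; move: vA vB.
rewrite !mem_octa => /eqP vi /eqP vj.
have ij : i = j by apply: (@octa_entry_inj v); rewrite vi vj.
by rewrite -vi -vj ij.
Qed.

Lemma card_K222_copies : #|copies K222 pencil_graph| = 21%N.
Proof.
have -> : copies K222 pencil_graph =
    [set octa x.1 x.2 | x in setX [set: 'I_3] [set~ (0 : vec)]].
  apply/setP=> A; apply/K222_copyP/imsetP => [[i [a [a0 ->]]]|[[i a]]].
    by exists (i, a); rewrite // !inE.
  by rewrite !inE => a0 ->; exists i, a.
by rewrite (card_in_imset octa_inj) cardsX cardsT cardsC1 card_ord !card_prod card_bool.
Qed.

Lemma linear_K222_copies : linear_copies K222 pencil_graph.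
Proof.
move=> A B AK BK; apply: contraNT; rewrite -ltnNge => /card_gt1P[v [u []]].
move=> /setIP[vA vB] /setIP[uA uB] vu.
case/K222_copyP: AK vA uA => i [a [_ ->]]; rewrite !mem_octa => /eqP<- /eqP ui.
case/K222_copyP: BK vB uB => j [b [_ ->]]; rewrite !mem_octa => /eqP<- /eqP uj.
have [->//|ij] := eqVneq i j; case/eqP: vu.
by apply: (eq_entry ij).
Qed.

Lemma covering_K222_copies : covering_copies K222 pencil_graph.
Proof.
move=> _ /edgesP[v [u [/adj_common_entry[i vu] ->]]]; exists (octa i (entry v i)).
  by rewrite octa_copy ?entry_neq0.
by rewrite subUset !sub1set !mem_octa vu eqxx.
Qed.

Lemma card_pencils : #|pencil_graph| = 42%N.
Proof.
apply/eqP; rewrite -(eqn_pmul2r (isT : (0 < 3)%N)).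
rewrite -(card_copies_regular card_K222_copies_at) card_K222_copies.
by rewrite card_prod !card_ord.
Qed.

Lemma card_K4_copies : #|copies K4 pencil_graph| = 42%N.
Proof.
have /eqP := card_copies_regular card_K4_copies_at.
by rewrite card_ord card_pencils eqn_pmul2r // => /eqP.
Qed.

Lemma card_edges_pencil : #|edges pencil_graph| = 252%N.
Proof.
apply/eqP; rewrite -(eqn_pmul2r (isT : (0 < 2)%N)).
by rewrite (card_edges_regular card_neighbours) card_pencils.
Qed.

(** * Connectedness *)

Lemma connect_common_entry u v i : entry u i = entry v i -> connect adj u v.
Proof.
move=> uvi; have [uv|uv] := eqVneq (pole u) (pole v); last first.
  by apply: connect1; rewrite adj_pencilE uv; apply/existsP; exists i; rewrite uvi.
have [w wv] := exists_missing v; apply: (@connect_trans _ _ (shift v i w)); last first.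
  by rewrite (sym_connect_sym (@adj_sym _)) connect1 ?adj_self_shift.
have shift_octa : shift v i w \in octa i (entry v i) by rewrite mem_octa entry_shift_id.
apply: connect1; rewrite (@octa_adj i (entry v i)) ?shift_octa ?mem_octa ?uvi // uv.
by rewrite -(@octa_adj i (entry v i)) ?shift_octa ?mem_octa ?adj_self_shift.
Qed.

Lemma pencil_connected : connected_graph pencil_graph.
Proof.
split=> [|u v]; first by rewrite card_pencils.
have [l /negPf l0 /andP[]] := line_through (pole u) (pole v).
case/pole_lineP=> [/eqP|[i ui]]; first by rewrite l0.
case/pole_lineP=> [/eqP|[j vj]]; first by rewrite l0.
have [ij|ij] := eqVneq i j.
  by apply: (@connect_common_entry u v i); rewrite -ui vj ij.
have [k ki kj] := ord3_third ij; rewrite eq_sym in ki; rewrite eq_sym in kj.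
have luj : l != entry u j by rewrite ui (inj_eq (@entry_inj u)).
have [x [xi xk]] := pencil_exists2 ki (negbT l0) (entry_neq0 u j) luj.
have [y [yj yk]] := pencil_exists2 kj (negbT l0) (entry_neq0 u j) luj.
have ux : connect adj u x by apply: (@connect_common_entry _ _ i); rewrite xi.
have xy : connect adj x y by apply: (@connect_common_entry _ _ k); rewrite xk.
have yv : connect adj y v by apply: (@connect_common_entry _ _ j); rewrite yj.
exact: connect_trans ux (connect_trans xy yv).
Qed.

(** * Automorphisms of the pencil graph *)

Lemma morph_add0 (M : vec -> vec) : {morph M : x y / x + y} -> M 0 = 0.
Proof. by move=> MD; rewrite -(addvv 0) MD addvv. Qed.

Lemma semilinear_missing (M : vec -> vec) sigma v v' w :
    {morph M : x y / x + y} -> injective M ->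
    (forall i, entry v' (sigma i) = M (entry v i)) ->
  (M w \in missing v') = (w \in missing v).
Proof.
move=> MD M_inj v'E; have M0 := morph_add0 MD.
apply: negb_inj; apply/missingPn/missingPn => [[Mw|[i Mw]]|[->|[i ->]]].
- by left; apply: M_inj; rewrite Mw.
- by right; exists (sigma^-1 i)%g; apply: M_inj; rewrite -v'E permKV.
- by left.
by right; exists (sigma i).
Qed.

Lemma semilinear_aut (M : vec -> vec) sigma :
    {morph M : x y / x + y} -> injective M ->
  exists2 s, s \in graph_aut pencil_graph &
    forall u i, entry (s u) (sigma i) = M (entry u i).
Proof.
move=> MD M_inj; have M0 := morph_add0 MD.
have /fin_all_exists[g gE] u : exists u', forall i, entry u' (sigma i) = M (entry u i).
  have [||u' u'E] := @pencil_exists (fun i => M (entry u (sigma^-1 i)%g)).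
  - by move=> i; rewrite -M0 (inj_eq M_inj) entry_neq0.
  - rewrite -(big_morph M MD M0) (reindex_perm sigma) /=.
    by rewrite (eq_bigr (entry u)) ?sum_entry // => i _; rewrite permK.
  by exists u' => i; rewrite u'E permK.
have g_inj : injective g.
  move=> u v guv; apply: (@eq_entry _ _ ord0 (lift ord0 ord0)) => //.
    by apply: M_inj; rewrite -!gE guv.
  by apply: M_inj; rewrite -!gE guv.
exists (perm g_inj) => [|u i]; last by rewrite permE.
apply/graph_autP=> u v; rewrite !permE.
apply/adj_pencilP/adj_pencilP => -[[i uvi] [j uj]].
  split; first by exists (sigma^-1 i)%g; apply: M_inj; rewrite -!gE permKV.
  exists (sigma^-1 j)%g; rewrite -(semilinear_missing _ MD M_inj (gE v)).
  by rewrite -(gE u) permKV.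
split; first by exists (sigma i); rewrite !gE uvi.
by exists (sigma j); rewrite gE (semilinear_missing _ MD M_inj (gE v)).
Qed.

Definition lincomb a b w (x : vec) : vec :=
  (if x.1.1 then a else 0) + (if x.1.2 then b else 0) + (if x.2 then w else 0).

Lemma lincombD a b w : {morph lincomb a b w : x y / x + y}.
Proof.
have ifD (c : vec) (s t : bool) :
    (if s + t then c else 0) = (if s then c else 0) + (if t then c else 0).
  by case: s t => [] []; rewrite ?addvv ?addr0 ?add0r.
by move=> x y; rewrite /lincomb !ifD [RHS]addrACA [X in _ = X + _]addrACA.
Qed.

Lemma lincomb_inj v i j w :
  i != j -> w \in missing v -> injective (lincomb (entry v i) (entry v j) w).
Proof.
move=> ij wv; have lincomb_eq0 x : lincomb (entry v i) (entry v j) w x = 0 -> x = 0.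
  case: x => [[s t] r] /= x0.
  have := in_line0 (pole v); rewrite -x0 /lincomb !in_lineD /=.
  have on_pole k (c : bool) : pole v \in line (if c then entry v k else 0).
    by case: c; rewrite ?pole_entry ?in_line0.
  rewrite !on_pole eqxx; case: r x0 => /=.
    by move: wv; rewrite in_missing => /negPf->.
  move=> + _; rewrite /lincomb /= addr0.
  case: s t => [] [] //=; rewrite ?addr0 ?add0r => /eqP.
  - by rewrite addv_eq0 (inj_eq (@entry_inj v)) (negPf ij).
  - by rewrite (negPf (entry_neq0 v i)).
  by rewrite (negPf (entry_neq0 v j)).
move=> x y xy; apply/eqP; rewrite -addv_eq0; apply/eqP/lincomb_eq0.
by rewrite lincombD xy addvv.
Qed.

Lemma basis_map v v' sigma w w' : w \in missing v -> w' \in missing v' ->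
  exists M : vec -> vec, [/\ {morph M : x y / x + y}, injective M, M w = w'
                           & forall i, M (entry v i) = entry v' (sigma i)].
Proof.
move=> wv wv'; pose i0 : 'I_3 := ord0; pose i1 : 'I_3 := lift ord0 ord0.
have i01 : i0 != i1 by [].
have s01 : sigma i0 != sigma i1 by rewrite (inj_eq perm_inj).
have v_inj := lincomb_inj i01 wv; have v'_inj := lincomb_inj s01 wv'.
pose M x := lincomb (entry v' (sigma i0)) (entry v' (sigma i1)) w' (invF v_inj x).
have ME x : M (lincomb (entry v i0) (entry v i1) w x) =
    lincomb (entry v' (sigma i0)) (entry v' (sigma i1)) w' x by rewrite /M invF_f.
have MD : {morph M : x y / x + y}.
  by move=> x y; rewrite -[x](f_invF v_inj) -[y](f_invF v_inj) -lincombD !ME lincombD.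
have Mi0 : M (entry v i0) = entry v' (sigma i0).
  by have := ME (true, false, false); rewrite /lincomb /= !addr0.
have Mi1 : M (entry v i1) = entry v' (sigma i1).
  by have := ME (false, true, false); rewrite /lincomb /= !addr0 !add0r.
exists M; split=> //.
- exact: inj_comp v'_inj (can_inj (f_invF v_inj)).
- by have := ME (false, false, true); rewrite /lincomb /= !add0r.
move=> i; have [->//|ii0] := eqVneq i i0; have [->//|ii1] := eqVneq i i1.
rewrite -(entryD v i01 ii0 ii1) MD Mi0 Mi1.
by rewrite (entryD v' (k := sigma i) s01) ?(inj_eq perm_inj).
Qed.

Lemma flag_transitive v v' sigma w w' : w \in missing v -> w' \in missing v' ->
  exists2 s, s \in graph_aut pencil_graph &
    [/\ s v = v', forall i, s (shift v i w) = shift v' (sigma i) w'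
      & forall i j, s (shift v i (w + entry v j)) =
                    shift v' (sigma i) (w' + entry v' (sigma j))].
Proof.
move=> wv wv'; have [M [MD M_inj Mw Mv]] := basis_map sigma wv wv'.
have [s sG sE] := semilinear_aut sigma MD M_inj; exists s => //.
have sv : s v = v'.
  by apply: (@eq_entry _ _ (sigma ord0) (sigma (lift ord0 ord0)));
    rewrite ?(inj_eq perm_inj) // sE Mv.
have s_shift i x : x \in missing v -> s (shift v i x) = shift v' (sigma i) (M x).
  move=> xv; have Mxv : M x \in missing v'.
    by rewrite (semilinear_missing (sigma := sigma) _ MD M_inj (v := v)).
  have sE_shift k :
      entry (s (shift v i x)) (sigma k) = entry (shift v' (sigma i) (M x)) (sigma k).
    rewrite sE !entry_shiftE // MD Mv (inj_eq perm_inj); congr (_ + _).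
    by case: ifP => // _; rewrite (morph_add0 MD).
  by apply: (@eq_entry _ _ (sigma ord0) (sigma (lift ord0 ord0)));
    rewrite ?(inj_eq perm_inj).
split=> // i => [|j]; first by rewrite s_shift ?Mw.
by rewrite s_shift ?MD ?Mw ?Mv // missingDr // entry_notin_missing.
Qed.

Lemma pencil_vertices_transitive :
  [transitive graph_aut pencil_graph, on [set: pencil_graph] | 'P]%g.
Proof.
have /card_gt0P[v _] : (0 < #|pencil_graph|)%N by rewrite card_pencils.
apply/imsetP; exists v; rewrite ?inE //; apply/setP=> u; rewrite inE; apply/esym/orbitP.
have [w wv] := exists_missing v; have [x xu] := exists_missing u.
have [s sG [sv _ _]] := flag_transitive 1%g wv xu.
by exists s.
Qed.

Lemma pencil_edges_transitive :
  [transitive graph_aut pencil_graph, on edges pencil_graph | 'P^*]%g.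
Proof.
have /card_gt0P[e eG] : (0 < #|edges pencil_graph|)%N by rewrite card_edges_pencil.
have actE (s : {perm pencil_graph}) u v : (('P^*)%act [set u; v] s = [set s u; s v])%g.
  by rewrite /= /setact imsetU1 imset_set1.
apply/imsetP; exists e => //; case/edgesP: eG => v [_ [/adj_shiftP[i [w [wv ->]]] ->]].
apply/setP=> e'; apply/edgesP/orbitP => [[u [u' [/adj_shiftP uu' ->]]]|[s sG <-]].
  have [j [x [xu ->]]] := uu'.
  have [s sG [sv s_shift _]] := flag_transitive (tperm i j) wv xu.
  by exists s => //; rewrite actE sv s_shift tpermL.
exists (s v), (s (shift v i w)); split; last by rewrite actE.
by rewrite (graph_autP _ sG) adj_self_shift.
Qed.

Lemma iso_extend_K4 : iso_extend K4 pencil_graph.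
Proof.
move=> A B f AK BK [f_inj fA _].
have /card_gt0P[v vA] : (0 < #|A|)%N by rewrite (card_copy AK) card_ord.
have [w wv AE] := K4_copy_tetra AK vA.
have fvB : f v \in B by rewrite -fA imset_f.
have [x xfv BE] := K4_copy_tetra BK fvB.
have shiftA i : shift v i w \in A by rewrite AE shift_tetra.
have /fin_all_exists[t tE] i : exists j, f (shift v i w) = shift (f v) j x.
  have : f (shift v i w) \in tetra (f v) x by rewrite -BE -fA imset_f.
  case/tetraP=> // /f_inj shift_v; have := adj_self_shift i wv.
  by rewrite shift_v ?adj_irr.
have t_inj : injective t.
  move=> i j tij; have /f_inj/eqP : f (shift v i w) = f (shift v j w) by rewrite !tE tij.
  by rewrite shift_eq // eqxx andbT => /(_ (shiftA i) (shiftA j))/eqP.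
have [s sG [sv s_shift _]] := flag_transitive (perm t_inj) wv xfv.
by exists s => // u; rewrite AE => /tetraP[->|[i ->]]; rewrite // s_shift permE tE.
Qed.

Lemma octa_antipode_uniq i a : {in octa i a & &, forall x y z,
  x != y -> x != z -> ~~ adj x y -> ~~ adj x z -> y = z}.
Proof.
move=> x y z xA yA zA xy xz; rewrite !(@octa_adj i a) // !negbK => /eqP pxy /eqP pxz.
have a0 : a != 0 by move: xA; rewrite mem_octa => /eqP<-; apply: entry_neq0.
have pa : pole x \in line a by rewrite -(imset_pole_octa i a0) imset_f.
apply/eqP; apply: contraT => yz.
have : [set x; y; z] \subset [set v in octa i a | pole v == pole x].
  apply/subsetP=> u; rewrite !inE -orbA => /or3P[] /eqP->;
    by rewrite -mem_octa ?xA ?yA ?zA -?pxy -?pxz eqxx.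
move/subset_leq_card; rewrite card_octa_pole // setUC cardsU1 cards2 !inE.
by rewrite xy eq_sym (negPf xz) eq_sym (negPf yz).
Qed.

Lemma octa_triangle_poles i a x y z t :
    triangle (octa i a) x y z -> t \in octa i a ->
  exists2 u, u \in [:: x; y; z] & pole u = pole t.
Proof.
case=> -[xA yA zA] + + + tA; rewrite !(@octa_adj i a) // => xy xz yz.
have a0 : a != 0 by move: xA; rewrite mem_octa => /eqP<-; apply: entry_neq0.
have lineE : line a = [set pole x; pole y; pole z].
  apply/esym/eqP; rewrite eqEcard card_line // setUC cardsU1 cards2 xy !inE.
  rewrite eq_sym (negPf xz) eq_sym (negPf yz) andbT; apply/subsetP=> p.
  by rewrite -(imset_pole_octa i a0) !inE => /or3P[] /eqP->; rewrite imset_f.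
have : pole t \in line a by rewrite -(imset_pole_octa i a0) imset_f.
rewrite lineE !inE -orbA => /or3P[] /eqP->; [exists x | exists y | exists z];
  by rewrite ?inE ?eqxx ?orbT.
Qed.

Lemma octa_iso_ext (f g : pencil_graph -> pencil_graph) A B x y z :
    A \in copies K222 pencil_graph -> B \in copies K222 pencil_graph ->
    copy_iso A B f -> copy_iso A B g -> triangle A x y z ->
    {in [:: x; y; z], f =1 g} ->
  {in A, f =1 g}.
Proof.
move=> /K222_copyP[i [a [_ AE]]] /K222_copyP[j [b [_ BE]]].
move=> [f_inj fA f_adj] [g_inj gA g_adj] xyz fg t tA.
have [u uxyz ut] : exists2 u, u \in [:: x; y; z] & pole u = pole t.
  by apply: (@octa_triangle_poles i a); rewrite -AE.
have uA : u \in A.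
  by case: xyz => -[xA yA zA] _ _ _; move: uxyz; rewrite !inE => /or3P[] /eqP->.
have [<-|uNt] := eqVneq u t; first exact: fg.
have uNadj : ~~ adj u t by rewrite (@octa_adj i a) -?AE // ut negbK.
apply: (@octa_antipode_uniq j b (f u)); rewrite -?BE -?fA ?imset_f ?(inj_in_eq f_inj) //.
- by rewrite fA -gA imset_f.
- by rewrite fg // (inj_in_eq g_inj).
- by rewrite f_adj.
by rewrite fg // g_adj.
Qed.

Lemma octa_neighbour v u i : adj v u -> entry v i = entry u i ->
  exists2 w, w \in missing v & u = shift v i w.
Proof.
move=> /adj_shiftP[j [w [wv ->]]]; have [->|ij] := eqVneq i j; first by exists w.
by rewrite entry_shift // => /esym/eqP; rewrite addv_eql (negPf (missing_neq0 wv)).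
Qed.

Lemma octa_triangle_shift i a v u t : triangle (octa i a) v u t ->
  exists w j, [/\ w \in missing v, j != i, u = shift v i w
                & t = shift v i (w + entry v j)].
Proof.
case=> -[]; rewrite !mem_octa => /eqP va /eqP ua /eqP ta vu vt ut.
have [w wv uE] := octa_neighbour vu (etrans va (esym ua)).
have [x xv tE] := octa_neighbour vt (etrans va (esym ta)).
move: ut; rewrite uE tE adj_shift_same // => /andP[wx wxi].
have [j ji wxj] := missing_sum_entry wv xv wx wxi; exists w, j; split=> //.
by rewrite -wxj addrA addvv add0r.
Qed.

Lemma octa_triangle_exists i a v : v \in octa i a ->
  exists u t, triangle (octa i a) v u t.
Proof.
rewrite mem_octa => /eqP va; have [w wv] := exists_missing v.
have [j ji] := ord3_other i.
have wjv : w + entry v j \in missing v by rewrite missingDr // entry_notin_missing.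
have shift_octa x : x \in missing v -> shift v i x \in octa i a.
  by move=> xv; rewrite mem_octa entry_shift_id // va.
exists (shift v i w), (shift v i (w + entry v j)); split.
- by split; [rewrite mem_octa va | apply: shift_octa | apply: shift_octa].
- exact: adj_self_shift.
- exact: adj_self_shift.
rewrite adj_shift_same // eq_sym addv_eql entry_neq0 addrA addvv add0r.
by rewrite (inj_eq (@entry_inj v)).
Qed.

Lemma octa_triangle_transitive i a v u t i' a' v' u' t' :
    triangle (octa i a) v u t -> triangle (octa i' a') v' u' t' ->
  exists2 s, s \in graph_aut pencil_graph & [/\ s v = v', s u = u' & s t = t'].
Proof.
move=> /octa_triangle_shift[w [j [wv ji -> ->]]].
move=> /octa_triangle_shift[w' [j' [wv' ji' -> ->]]].
have [sigma [<- <-]] := perm_extends_pair ji ji'.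
have [s sG [sv s_w s_wj]] := flag_transitive sigma wv wv'.
by exists s.
Qed.

Lemma iso_extend_K222 : iso_extend K222 pencil_graph.
Proof.
move=> A B f AK BK f_iso; have [_ fA _] := f_iso.
have /K222_copyP[i [a [_ AE]]] := AK; have /K222_copyP[i' [a' [_ BE]]] := BK.
have /card_gt0P[v vA] : (0 < #|A|)%N by rewrite (card_copy AK) card_prod !card_ord.
have [u [t vut]] : exists u t, triangle A v u t.
  by rewrite AE; apply: octa_triangle_exists; rewrite -AE.
have [s sG [sv su st]] : exists2 s, s \in graph_aut pencil_graph &
    [/\ s v = f v, s u = f u & s t = f t].
  apply: (@octa_triangle_transitive i a _ _ _ i' a'); rewrite -?AE -?BE //.
  exact: copy_iso_triangle vut.
exists s => //; have [[_ uA _] vu _ _] := vut; apply: (octa_iso_ext AK BK) vut _ => //.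
  split=> [x y _ _|| x y _ _]; [exact: perm_inj | | exact: (graph_autP _ sG)].
  apply: (graph_aut_copy_eq linear_K222_copies sG AK BK vu) => //.
    by rewrite sv -fA imset_f.
  by rewrite su -fA imset_f.
by move=> x; rewrite !inE => /or3P[] /eqP->.
Qed.

Lemma aut_shift (s : {perm pencil_graph}) v i w x :
    s \in graph_aut pencil_graph -> w \in missing v -> x \in missing v ->
    s v = v -> s (shift v i w) = shift v i w ->
  exists2 y, y \in missing v & s (shift v i x) = shift v i y.
Proof.
move=> sG wv xv sv s_w; pose A := octa i (entry v i).
have AK : A \in copies K222 pencil_graph by rewrite octa_copy ?entry_neq0.
have shiftA y : y \in missing v -> shift v i y \in A.
  by move=> yv; rewrite mem_octa entry_shift_id.
have vA : v \in A by rewrite mem_octa.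
have sA : s @: A = A.
  apply: (graph_aut_copy_eq linear_K222_copies sG AK AK (adj_self_shift i wv));
    by rewrite ?sv ?s_w ?shiftA.
have : s (shift v i x) \in A by rewrite -sA imset_f ?shiftA.
rewrite mem_octa => /eqP/esym; apply: octa_neighbour.
by rewrite -{1}sv (graph_autP _ sG) adj_self_shift.
Qed.

(* The image of shift v i x is shift v i y for the same y at every position i.    *)
(* If w + x is entry v k, then shift v k w and shift v k x are opposite vertices  *)
(* of an octahedron, which forces y = x.                                          *)
Lemma aut_fixes_neighbours (s : {perm pencil_graph}) v w :
    s \in graph_aut pencil_graph -> w \in missing v -> s v = v ->
    (forall i, s (shift v i w) = shift v i w) ->
  forall u, adj v u -> s u = u.
Proof.
move=> sG wv sv s_w _ /adj_shiftP[i [x [xv ->]]]; have s_adj := graph_autP _ sG.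
have [->|xw] := eqVneq x w; first exact: s_w.
have /fin_all_exists2[t tv s_x] j := aut_shift sG wv xv sv (s_w j).
have t_const j k : t j = t k.
  have [->//|jk] := eqVneq j k; apply/eqP.
  by rewrite -(adj_shift_diff (tv j) (tv k) jk) -!s_x s_adj adj_shift_diff.
have [/eqP|[k wxk]] := missingPn _ _ (missingD wv xv).
  by rewrite addv_eq0 eq_sym (negPf xw).
rewrite s_x (t_const i k); congr shift; apply: (addrI w); rewrite wxk.
have tkw : w != t k.
  apply: contraNneq xw => wtk; have := s_x k; rewrite -wtk -(s_w k) => /perm_inj/eqP.
  by rewrite shift_eq // => /andP[].
have : ~~ adj (shift v k w) (shift v k (t k)).
  by rewrite -s_x -(s_w k) s_adj adj_shift_same // wxk eqxx andbF.
by rewrite adj_shift_same // tkw negbK => /eqP.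
Qed.

Lemma aut_fixes_neighbours_step (s : {perm pencil_graph}) v y :
    s \in graph_aut pencil_graph -> s v = v -> (forall u, adj v u -> s u = u) ->
  adj v y -> forall u, adj y u -> s u = u.
Proof.
move=> sG sv s_v vy; have sy := s_v y vy; case/adj_shiftP: vy => i [w [wv yE]].
have y_tetra : y \in tetra v w by rewrite yE shift_tetra.
have [x xy tetraE] := K4_copy_tetra (tetra_copy wv) y_tetra.
apply: (aut_fixes_neighbours sG xy sy) => j.
have : shift y j x \in tetra v w by rewrite tetraE shift_tetra.
by case/tetraP=> [->|[k ->]] //; apply: s_v; apply: adj_self_shift.
Qed.

Lemma pencil_aut_rigid (s : {perm pencil_graph}) A :
    A \in copies K4 pencil_graph -> s \in graph_aut pencil_graph ->
  {in A, s =1 id} -> s = 1%g.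
Proof.
move=> AK sG sA; have /card_gt0P[v vA] : (0 < #|A|)%N by rewrite (card_copy AK) card_ord.
have [w wv AE] := K4_copy_tetra AK vA.
have sv := sA v vA; have s_v : forall u, adj v u -> s u = u.
  by apply: (aut_fixes_neighbours sG wv sv) => i; rewrite sA // AE shift_tetra.
apply/permP=> u; rewrite perm1; have /connectP[q + ->] := pencil_connected.2 v u.
elim: q v sv s_v {vA wv AE} => [v //|y q IH v sv s_v /= /andP[vy]].
by apply: IH; [apply: s_v | apply: aut_fixes_neighbours_step vy].
Qed.

Lemma card_graph_aut_pencil : #|graph_aut pencil_graph| = 1008%N.
Proof.
have /card_gt0P[A AK] : (0 < #|copies K4 pencil_graph|)%N by rewrite card_K4_copies.
rewrite (card_graph_aut_rigid iso_extend_K4 AK) => [|s]; last exact: pencil_aut_rigid.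
by rewrite card_K4_copies card_graph_aut_complete.
Qed.

End Pencils.

Lemma Hgraph_K4_pencil : Hgraph K4 42 4 pencil_graph.
Proof.
apply: (Hgraph_of_copies linear_K4_copies covering_K4_copies) => //.
- exact: complete_connected.
- exact: complete_regular.
- exact: pencil_connected.
- exact: card_K4_copies_at.
exact: card_K4_copies.
Qed.

Lemma Hgraph_K222_pencil : Hgraph K222 21 3 pencil_graph.
Proof.
apply: (Hgraph_of_copies linear_K222_copies covering_K222_copies) => //.
- exact: multipartite_connected.
- exact: multipartite_regular.
- exact: pencil_connected.
- exact: card_K222_copies_at.
exact: card_K222_copies.
Qed.

Lemma K4_K222_not_isomorphic : ~ isomorphic K4 K222.
Proof. by case=> f [/bij_eq_card]; rewrite card_prod !card_ord. Qed.

Local Open Scope group_scope.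

Theorem theorem5p1 :
  [/\ HHgraph K4 42 4 K222 21 3 pencil_graph,
      ultrahomogeneous K4 K222 pencil_graph,
      fastened K4 K222 pencil_graph,
      ~ line_graphical K4 42 4 K222 21 3 pencil_graph
    & ~ line_graphical K222 21 3 K4 42 4 pencil_graph] /\
  (#|graph_aut pencil_graph| = 1008 /\
   1008 = 4 * #|edges pencil_graph|)%N /\
  [/\ [transitive graph_aut pencil_graph, on edges pencil_graph | 'P^*],
      {in edges pencil_graph, forall e,
         #|'C_(graph_aut pencil_graph)[e | 'P^*]| = 4}
    & {in edges pencil_graph, forall e,
         coset_correspondence 'P^* (graph_aut pencil_graph)
           (edges pencil_graph) e}] /\
  [/\ [transitive graph_aut pencil_graph, on [set: pencil_graph] | 'P],
      forall v : pencil_graph, #|'C_(graph_aut pencil_graph)[v | 'P]| = 24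
    & forall v : pencil_graph,
        coset_correspondence 'P (graph_aut pencil_graph) [set: pencil_graph] v].
Proof.
pose A := graph_aut_group pencil_graph.
have cardV : #|[set: pencil_graph]| = 42 by rewrite cardsT card_pencils.
split; last split; last split.
- split; [| | | by case | by case].
  + split; first exact: K4_K222_not_isomorphic.
      exact: Hgraph_K4_pencil.
    exact: Hgraph_K222_pencil.
  + by split; [apply: iso_extend_K4 | apply: iso_extend_K222].
  move=> e eG; split.
    exact: (card_copies_on_edge linear_K4_copies covering_K4_copies eG).
  exact: (card_copies_on_edge linear_K222_copies covering_K222_copies eG).
- by rewrite card_graph_aut_pencil card_edges_pencil.
- split=> [|e eG|e eG]; first exact: pencil_edges_transitive.
    apply: (card_transitive_stab (A := A) pencil_edges_transitive eG).
    by rewrite card_graph_aut_pencil card_edges_pencil.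
  exact: (transitive_coset_correspondence (A := A) pencil_edges_transitive eG).
split=> [|v|v]; first exact: pencil_vertices_transitive.
  apply: (card_transitive_stab (A := A) pencil_vertices_transitive); rewrite ?in_setT //.
  by rewrite card_graph_aut_pencil cardV.
by apply: (transitive_coset_correspondence (A := A) pencil_vertices_transitive);
  rewrite in_setT.
Qed.
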